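(* Let $f_n \colon [-1,1] \to [-1,1]$, $n = 1,2,\ldots$, be piecewise-linear maps with $f_n(0) = 0$ and with $f_n{\restriction}_{[-1,0]}$ and $f_n{\restriction}_{[0,1]}$ both non-constant for each $n$. Suppose that for each $n$: (1) $f_n$ and $f_n \circ f_{n+1}$ have the same radial contour factor, i.e. $t_{f_n} = t_{f_n \circ f_{n+1}}$; and (2) $f_n$ has no contour twins. Then there exists an embedding of $X = \varprojlim \langle [-1,1], f_n \rangle$ into $\mathbb{R}^2$ for which the point $\langle 0,0,\ldots \rangle \in X$ is accessible.
   Context: ''Map'' means continuous function. A map between intervals is piecewise-linear if there is a finite subset of the domain containing its endpoints such that the map is linear (affine) on the intervals between consecutive points of the set. Inverse limit: $\varprojlim \langle [-1,1], f_n \rangle = \{ \langle x_n \rangle_{n=1}^\infty : f_n(x_{n+1}) = x_n \text{ for each } n \}$, a subspace of the product $\prod_{n=1}^\infty [-1,1]$. If $\Omega \colon X \to \mathbb{R}^2$ is an embedding and $x \in X$, then $x$ is accessible (for $\Omega$) if there is an arc $A \subset \mathbb{R}^2$ with $A \cap \Omega(X) = \{\Omega(x)\}$. One-sided notions. Let $g \colon [0,1] \to [-1,1]$ be a map with $g(0)=0$. A departure of $g$ is a number $x \in (0,1]$ such that $g(x) \notin g([0,x))$; it is positively oriented if $g(x) > 0$ and negatively oriented if $g(x) < 0$. A contour point of $g$ is a departure $\alpha$ such that for any departure $x > \alpha$ of $g$ there is a departure $y$ of $g$, of orientation opposite to that of $\alpha$, with $\alpha < y \leq x$. If $g$ is piecewise-linear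 and non-constant, it has finitely many, and at least one, contour points $\alpha_1 < \cdots < \alpha_n$; put $\alpha_0 = 0$. The contour factor of $g$ is the piecewise-linear map $t_g \colon [0,1] \to [-1,1]$ with $t_g(i/n) = g(\alpha_i)$ for $i = 0,\ldots,n$, linear between these points. Two-sided notions. Let $\mathsf{r} \colon [0,1] \to [-1,0]$, $\mathsf{r}(x) = -x$. Let $f \colon [-1,1] \to [-1,1]$ be a map with $f(0) = 0$. A right contour point of $f$ is a contour point of $f{\restriction}_{[0,1]}$; a left contour point of $f$ is a number $\beta < 0$ such that $-\beta$ is a contour point of $f{\restriction}_{[-1,0]} \circ \mathsf{r}$. If $f$ is piecewise-linear and non-constant on each of $[-1,0]$ and $[0,1]$, the radial contour factor of $f$ is the piecewise-linear map $t_f \colon [-1,1] \to [-1,1]$ such that $t_f{\restriction}_{[0,1]}$ is the contour factor of $f{\restriction}_{[0,1]}$ and $t_f{\restriction}_{[-1,0]} \circ \mathsf{r}$ is the contour factor of $f{\restriction}_{[-1,0]} \circ \mathsf{r}$. $f$ has no contour twins if: (a) $0$ is neither a local minimum nor a local maximum of $f$ (in the non-strict sense); and (b) whenever $\alpha$ is a right contour point and $\alpha'$ is a left contour point of $f$ with $0 < \alpha < 1$ and $-1 < \alpha' < 0$, then $f(\alpha) \neq f(\alpha')$. *)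

(* Defs.v *)
From HB Require Import structures.
From mathcomp Require Import all_boot all_order all_algebra.
From mathcomp Require Import all_classical all_reals all_analysis.

Set Implicit Arguments.
Unset Strict Implicit.
Unset Printing Implicit Defensive.

Import Order.TTheory GRing.Theory Num.Theory.
Import numFieldNormedType.Exports.
Local Open Scope classical_set_scope.
Local Open Scope ring_scope.

(* Maps defined on an interval are represented by total functions R -> R; every
   predicate below depends only on the values taken on the relevant interval. *)

Section Topology.

(* h restricted to A is a homeomorphism onto its image. *)
Definition embedding (T U : topologicalType) (A : set T) (h : T -> U) : Prop :=
  {within A, continuous h} /\
  exists g : U -> T,
    (forall x, A x -> g (h x) = x) /\ {within h @` A, continuous g}.

Definition is_arc (R : realType) (A : set (R * R)) : Prop :=
  exists gamma : R -> R * R,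
    embedding `[0 : R, 1] gamma /\ A = gamma @` `[0 : R, 1].

Definition accessible (R : realType) (T : topologicalType) (X : set T)
    (h : T -> R * R) (x : T) : Prop :=
  exists A : set (R * R), is_arc A /\ A `&` (h @` X) = [set h x].

(* {ptws nat -> R} carries the product topology. *)
Definition inverse_limit (R : realType) (f : nat -> R -> R) :
    set {ptws nat -> R} :=
  [set x | (forall n, x n \in `[-1, 1]) /\ (forall n, f n (x n.+1) = x n)].

End Topology.

Section IntervalMaps.
Variable R : realType.
Implicit Types (a b x y alpha : R) (f g t : R -> R) (s : seq R).

Definition affine_on a b f : Prop :=
  exists m c : R, forall x, x \in `[a, b] -> f x = m * x + c.

Definition piecewise_linear a b f : Prop :=
  exists2 s, itv_partition a b s &
    forall i, (i < size s)%N ->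
      affine_on (nth a (a :: s) i) (nth a (a :: s) i.+1) f.

Definition constant_on a b f : Prop :=
  exists c : R, forall x, x \in `[a, b] -> f x = c.

Definition selfmap f : Prop :=
  {within `[-1, 1], continuous f} /\
  (forall x, x \in `[-1, 1] -> f x \in `[-1, 1]).

Definition departure g x : Prop :=
  x \in `]0, 1] /\ ~ (g @` `[0, x[) (g x).

Definition opposite_orientation g x y : Prop :=
  (0 < g x /\ g y < 0) \/ (g x < 0 /\ 0 < g y).

Definition contour_point g alpha : Prop :=
  departure g alpha /\
  forall x, departure g x -> alpha < x ->
    exists y, [/\ departure g y, opposite_orientation g alpha y, alpha < y
                & y <= x].

(* s lists the contour points alpha_1 < ... < alpha_n, and t satisfies the
   conditions that determine the contour factor of g on [0, 1]. *)
Definition contour_factor g t : Prop :=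
  exists s, let n := size s in
    [/\ sorted <%R s,
        forall x, x \in s <-> contour_point g x,
        (0 < n)%N,
        forall i, (i <= n)%N -> t (i%:R / n%:R) = g (nth 0 (0 :: s) i)
      & forall i, (i < n)%N -> affine_on (i%:R / n%:R) (i.+1%:R / n%:R) t].

Definition radial_contour_factor f t : Prop :=
  contour_factor f t /\ contour_factor (f \o -%R) (t \o -%R).

(* A radial contour factor is unique on [-1, 1], so this says that both maps
   have one and that the two are equal. *)
Definition same_radial_contour_factor f g : Prop :=
  exists t, radial_contour_factor f t /\ radial_contour_factor g t.

Definition right_contour_point f alpha : Prop := contour_point f alpha.

Definition left_contour_point f beta : Prop :=
  beta < 0 /\ contour_point (f \o -%R) (- beta).

Definition local_min f x : Prop := \forall y \near x, f x <= f y.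

Definition local_max f x : Prop := \forall y \near x, f y <= f x.

Definition no_contour_twins f : Prop :=
  (~ local_min f 0 /\ ~ local_max f 0) /\
  forall alpha alpha', right_contour_point f alpha ->
    left_contour_point f alpha' ->
    0 < alpha < 1 -> -1 < alpha' < 0 -> f alpha <> f alpha'.

End IntervalMaps.

(* Main.v *)
(** Each [f n] factors as [T n \o s n] through its radial contour factor [T n].
As [f n] and [f n \o f n.+1] have the same contour factor, the latter also
factors through [T n], say as [T n \o sigma n], and there is a choice of
[sigma n].  We take [s n \o f n.+1] on the right arm, and on the left arm the
lift of [f n \o f n.+1] that stays on the left.  If [sigma n \o f n.+2] took on
the left arm a value above all its values on the right arm, and conversely, then
the arms of [f n.+2] would cross; equality of contour factors would then force
both arms of [f n] to have a plateau with the same upper (or lower) end, which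
the absence of contour twins forbids.  The inverse limit of the [f n] is that of
the maps [G k = sigma (2k) \o T (2k+2)], none of which has such a negative
departure.

For such a map [G], a mountain-climbing argument applied to [G (- x)] and
[G x + e] gives an embedding of the square [[0,2]^2] into itself that fixes the
corner and moves the interval [-1, 1], bent along the two axes, to within [e] of
its image under [G].  Composing these embeddings, with [e] decreasing fast
enough, yields a planar embedding of the inverse limit in the closed quadrant
that sends the thread 0 to the corner, which is accessible along the diagonal. *)

(* Both hypotheses enter through growing intervals. The values taken along one arm up to a given
   time form an interval; equality of contour factors says that, arm by arm, [f n \o f n.+1] passes
   only through intervals that [f n] passes through, and absence of twins says that the intervals of
   the two arms of [f n] never pause at the same upper or lower end. Crossings are studied by
   comparing such intervals, never times.

   The lifts are needed because an [f n] can itself have negative departures: [f 0 x = - x] followed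
   by identities satisfies every hypothesis.

   In the planar step two climbers move along the arms of [G], the left one never above the right
   one, and at each moment the bent line is folded onto the interval between their heights; a
   negative departure is the only obstruction to such a climb. The shift by [e] absorbs the error of
   sampling [G] at finitely many points. The side 2 of the square leaves room to prolong the arms
   past 1, down to -1 and up to [1 + e], so that the climb ends at positions that dominate all
   others. *)
Require Import Defs.
From HB Require Import structures.
From mathcomp Require Import all_boot all_order all_algebra.
From mathcomp Require Import all_classical all_reals all_analysis.
From mathcomp Require Import ring lra.

Set Implicit Arguments.
Unset Strict Implicit.
Unset Printing Implicit Defensive.

Import Order.TTheory GRing.Theory Num.Theory.
Import numFieldNormedType.Exports.
Local Open Scope classical_set_scope.
Local Open Scope ring_scope.

(* lra preprocesses every hypothesis; dropping the irrelevant ones is much faster. *)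
Ltac order_fact T :=
  lazymatch T with
  | is_true (_ <= _) => idtac
  | is_true (_ < _) => idtac
  | is_true (_ && _) => idtac
  | is_true (~~ _) => idtac
  | is_true _ -> _ => idtac
  | ~ _ => idtac
  | _ = _ => idtac
  | _ /\ _ => idtac
  | _ \/ _ => idtac
  end.
Ltac rlra :=
  repeat match goal with H : ?T |- _ => tryif order_fact T then fail else clear H end;
  lra.

(** * Ranges *)

Section Ranges.
Variable R : realType.
Implicit Types (f g h s t : R -> R) (a b c d lo hi p q r v x y z : R).

Lemma le_or_lt x y : x <= y \/ y < x.
Proof. by apply/orP; rewrite leNgt orNb. Qed.

Lemma approach_left x y d : x < y -> 0 < d -> exists z, [/\ x <= z, z < y & y - d / 2 <= z].
Proof.
by move=> xy d0; exists (Num.max x (y - d / 2)); rewrite maxEle; case: ifP => ?; split; rlra.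
Qed.

Lemma ivt_between f a b v : continuous f -> a <= b ->
  f a <= v <= f b \/ f b <= v <= f a -> exists2 x, a <= x <= b & f x = v.
Proof.
move=> cf ab hv.
have [|x xab <-] := @IVT R f a b v ab (continuous_subspaceT cf).
  rewrite minEle maxEle; case: ifP => h; case: hv => hv; rlra.
by exists x => //; rewrite in_itv in xab.
Qed.

Lemma attains_max f a b : continuous f -> a <= b ->
  exists2 x, a <= x <= b & forall y, a <= y <= b -> f y <= f x.
Proof.
move=> cf ab; have [x xab hx] := @EVT_max R f a b ab (continuous_subspaceT cf).
by exists x => [|y yab]; [rewrite in_itv in xab|apply: hx; rewrite in_itv].
Qed.

Lemma attains_min f a b : continuous f -> a <= b ->
  exists2 x, a <= x <= b & forall y, a <= y <= b -> f x <= f y.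
Proof.
move=> cf ab; have [x xab hx] := @EVT_min R f a b ab (continuous_subspaceT cf).
by exists x => [|y yab]; [rewrite in_itv in xab|apply: hx; rewrite in_itv].
Qed.

Lemma continuousN f : continuous f -> continuous (fun x => - f x).
Proof. by move=> cf x; apply: continuousN; exact: cf. Qed.

Lemma continuous_refl f : continuous f -> continuous (fun x => f (- x)).
Proof.
move=> cf x; apply: (@continuous_comp _ _ _ -%R f); last exact: cf.
exact: opp_continuous.
Qed.

Lemma continuous_compU (U V W : topologicalType) (f : U -> V) (g : V -> W) :
  continuous f -> continuous g -> continuous (g \o f).
Proof. by move=> cf cg x; apply: continuous_comp; [exact: cf|exact: cg]. Qed.

Lemma continuous_gt_ball f x v : continuous f -> v < f x ->
  exists2 e, 0 < e & forall y, `|x - y| < e -> v < f y.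
Proof.
move=> cf vx.
have /cvgrPdist_lt near_fx := cf x.
have [e /= e0 he] := near_fx (f x - v) (etrans (subr_gt0 _ _) vx).
exists e => // y /he /=; rewrite ltr_norml => /andP[]; rlra.
Qed.

(** [S] collects the ends of initial segments on which [f] stays strictly below [v], and [y] is its
    supremum. Continuity excludes [f y > v] by a point just before [y] and [f y < v] by a point just
    after it. *)
Lemma first_hit f b v : continuous f -> 0 <= b -> f 0 <= v <= f b ->
  exists y, [/\ 0 <= y <= b, f y = v & forall x, 0 <= x < y -> f x < v].
Proof.
move=> cf b0 hv.
pose S := [set y | 0 <= y <= b /\ forall x, 0 <= x <= y -> f x < v].
have [fv|fv] := eqVneq (f 0) v.
  by exists 0; split => // [|x]; rlra.
have S0 : S 0 by split => [|x hx]; [rlra|have -> : x = 0 by rlra]; rlra.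
have Sb : has_sup S.
  by split; [exists 0|exists b => y [] /andP[]].
pose y := sup S.
have y0 : 0 <= y by apply: ub_le_sup => //; case: Sb.
have yb : y <= b by apply: ge_sup; [exists 0|move=> z [] /andP[]].
have low x : 0 <= x < y -> f x < v.
  move=> /andP[x0 xy]; have [z [_ hz] xz] := sup_gt (ex_intro _ 0 S0) xy.
  by apply: hz; rlra.
exists y; split => //; first rlra.
apply/eqP; rewrite eq_le; apply/andP; split; rewrite leNgt; apply/negP => fy.
  have [e e0 he] := continuous_gt_ball cf fy.
  have y1 : 0 < y by rewrite lt_neqAle y0 andbT; apply/eqP => y'; move: fy; rewrite -y'; rlra.
  have [z [z1 z2 z3]] := approach_left y1 e0.
  have := low z; have := he z; rewrite ltr_norml; rlra.
have fyN : - v < - f y by rewrite ltrN2.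
have [e e0 he] := continuous_gt_ball (continuousN cf) fyN.
have yb' : - b < - y.
  by rewrite ltrN2 lt_neqAle yb andbT; apply/eqP => y'; move: fy; rewrite y'; rlra.
have [z [z1 z2 z3]] := approach_left yb' e0.
have : S (- z).
  split=> [|x hx]; first rlra.
  case: (le_or_lt y x) => xy; last by apply: low; rlra.
  by have := he x; rewrite ltr_norml; rlra.
move=> /(ub_le_sup (proj2 Sb)); rewrite -/y; rlra.
Qed.

(** For continuous [f] this is the image interval; in terms of attained bounds it passes through
    negation, reflection and composition. *)
Definition range_on f a b lo hi :=
  [/\ forall x, a <= x <= b -> lo <= f x <= hi,
      exists2 x, a <= x <= b & f x = lo & exists2 x, a <= x <= b & f x = hi].

Lemma range_bounds f a b lo hi p q : range_on f a b lo hi ->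
  (forall x, a <= x <= b -> p <= f x <= q) -> p <= lo /\ hi <= q.
Proof. by move=> [_ [x xab <-] [y yab <-]] hf; have := hf x; have := hf y; rlra. Qed.

Lemma range_exists f a b : continuous f -> a <= b ->
  exists lo hi, range_on f a b lo hi.
Proof.
move=> cf ab; have [x xab hx] := attains_min cf ab.
have [y yab hy] := attains_max cf ab.
exists (f x), (f y); split; [|by exists x|by exists y].
by move=> z zab; rewrite hx// hy.
Qed.

Lemma range_eq f g a b lo hi : (forall x, a <= x <= b -> f x = g x) ->
  range_on f a b lo hi -> range_on g a b lo hi.
Proof.
move=> fg [h [x xab fx] [y yab fy]]; split.
- by move=> z zab; rewrite -fg//; exact: h.
- by exists x => //; rewrite -fg.
- by exists y => //; rewrite -fg.
Qed.

Lemma range_onto f a b lo hi v : continuous f -> range_on f a b lo hi ->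
  lo <= v <= hi -> exists2 x, a <= x <= b & f x = v.
Proof.
move=> cf [_ [x xab fx] [y yab fy]] hv.
case: (le_or_lt x y) => [xy|yx].
  have [|z zxy <-] := @ivt_between f x y v cf xy; first by left; rlra.
  by exists z => //; rlra.
have [|z zxy <-] := @ivt_between f y x v cf (ltW yx); first by right; rlra.
by exists z => //; rlra.
Qed.

Lemma range_comp f g a b lo hi p q : continuous g -> range_on g a b lo hi ->
  range_on f lo hi p q -> range_on (f \o g) a b p q.
Proof.
move=> cg rg [h [x xab fx] [y yab fy]]; split.
- by move=> z zab; apply: h; case: rg => h' _ _; exact: h'.
- by have [z zab gz] := range_onto cg rg xab; exists z => //=; rewrite gz.
- by have [z zab gz] := range_onto cg rg yab; exists z => //=; rewrite gz.
Qed.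

Lemma rangeN f a b lo hi :
  range_on f a b lo hi -> range_on (fun x => - f x) a b (- hi) (- lo).
Proof.
move=> [h [x xab fx] [y yab fy]]; split.
- by move=> z /h; rlra.
- by exists y; rewrite ?fy.
- by exists x; rewrite ?fx.
Qed.

Lemma range_refl f a b lo hi :
  range_on f a b lo hi -> range_on (fun x => f (- x)) (- b) (- a) lo hi.
Proof.
move=> [h [x xab fx] [y yab fy]]; split.
- by move=> z zab; apply: h; rlra.
- by exists (- x); rewrite ?opprK; rlra.
- by exists (- y); rewrite ?opprK; rlra.
Qed.

Lemma range_reflE f a b lo hi :
  range_on (fun x => f (- x)) a b lo hi <-> range_on f (- b) (- a) lo hi.
Proof.
split=> [/range_refl|/range_refl]; last by rewrite !opprK.
by apply: range_eq => x; rewrite opprK.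
Qed.

Lemma rangeNE f a b lo hi :
  range_on (fun x => - f x) a b lo hi <-> range_on f a b (- hi) (- lo).
Proof.
split=> [/rangeN|/rangeN]; last by rewrite !opprK.
by apply: range_eq => x; rewrite opprK.
Qed.

End Ranges.

(** * Crossings *)

Section Crossings.
Variable R : realType.
Implicit Types (f g h s t : R -> R) (C : R -> R -> Prop).
Implicit Types (a b c d lo hi p q r v x y z m M w : R).

(* The ranges of f on [0, y] increase with y: they form a chain under inclusion. *)
Definition chain f lo hi := exists2 y, 0 <= y <= 1 & range_on f 0 y lo hi.

(** The upper end rests at [r] while the lower end sinks from [q] to [p]: the running maximum pauses
    during a new descent. *)
Definition plateau_hi C r := exists p q, [/\ p < q, C p r & C q r].
Definition plateau_lo C p := exists q r, [/\ q < r, C p q & C p r].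

(* A plateau ends at the value of f at a contour point, or at 0 if f has a local
   extremum there, so this follows from the absence of contour twins. *)
Definition twinless f := forall r,
  ~ (plateau_hi (chain f) r /\ plateau_hi (chain (f \o -%R)) r) /\
  ~ (plateau_lo (chain f) r /\ plateau_lo (chain (f \o -%R)) r).

(** This is what equality of contour factors contributes to the study of crossings; [lift_chain]
    derives it. *)
Definition subordinate f h :=
  (forall lo hi, chain (f \o h) lo hi -> chain f lo hi) /\
  (forall lo hi, chain (f \o h \o -%R) lo hi -> chain (f \o -%R) lo hi).

(* The right arm of h has reached further to the left than the left arm, and the
   left arm further to the right than the right arm. *)
Definition crossing h x1 x2 m M w1 w2 :=
  [/\ 0 <= x1 <= 1, 0 <= x2 <= 1, range_on h 0 x2 w1 M, range_on h (- x1) 0 m w2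
    & [/\ - 1 <= w1, w1 < m, M < w2 & w2 <= 1]].

Lemma chainN f lo hi : chain (fun x => - f x) lo hi <-> chain f (- hi) (- lo).
Proof.
by split=> -[y y01 rf]; exists y => //; [exact/rangeNE|exact/rangeNE].
Qed.

Lemma chain_le f p q p' q' : chain f p q -> chain f p' q' ->
  (p <= p' /\ q' <= q) \/ (p' <= p /\ q <= q').
Proof.
move=> [y y01 [h1 [a ay fa] [b by_ fb]]] [z z01 [h2 [c cz fc] [d dz fd]]].
case: (le_or_lt y z) => [yz|zy]; [right|left].
  have := h2 a; have := h2 b; rlra.
have := h1 c; have := h1 d; rlra.
Qed.

Lemma plateau_hiN f r :
  plateau_hi (chain (fun x => - f x)) r -> plateau_lo (chain f) (- r).
Proof.
move=> [p [q [pq /chainN h1 /chainN h2]]]; exists (- q), (- p); split => //; rlra.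
Qed.

Lemma plateau_loN f r :
  plateau_lo (chain (fun x => - f x)) r -> plateau_hi (chain f) (- r).
Proof.
move=> [p [q [pq /chainN h1 /chainN h2]]]; exists (- q), (- p); split => //; rlra.
Qed.

Lemma twinlessN f : twinless f -> twinless (fun x => - f x).
Proof.
move=> nt r; have [nt1 nt2] := nt (- r); split=> -[h1 h2].
  by apply: nt2; split; [exact: plateau_hiN|exact: (@plateau_hiN (f \o -%R))].
by apply: nt1; split; [exact: plateau_loN|exact: (@plateau_loN (f \o -%R))].
Qed.

Lemma reflK f : (f \o -%R) \o -%R = f.
Proof. by apply/funext => x /=; rewrite opprK. Qed.

Lemma twinless_refl f : twinless f -> twinless (f \o -%R).
Proof.
by move=> nt r; rewrite /twinless reflK; have [nt1 nt2] := nt r; split=> -[h1 h2];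
  [apply: nt1|apply: nt2].
Qed.

Lemma subordinateN f h : subordinate f h -> subordinate (fun x => - f x) h.
Proof.
by move=> [h1 h2]; split=> lo hi /chainN hc; apply/chainN; [exact: h1|exact: h2].
Qed.

(** Conjugation by the reflection: it exchanges the arms and preserves crossings, so each estimate
    on one arm has a mirror image on the other. *)
Definition swap h : R -> R := fun x => - h (- x).

Lemma comp_swap f h : (f \o -%R) \o swap h = (f \o h) \o -%R.
Proof. by apply/funext => x; rewrite /swap /= opprK. Qed.

Lemma subordinate_refl f h : subordinate f h -> subordinate (f \o -%R) (swap h).
Proof.
by rewrite /subordinate comp_swap !reflK => -[h1 h2]; split.
Qed.

Lemma crossing_swap h x1 x2 m M w1 w2 : crossing h x1 x2 m M w1 w2 ->
  crossing (swap h) x2 x1 (- M) (- m) (- w2) (- w1).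
Proof.
move=> [x10 x20 r1 r2 [w10 w1m Mw2 w21]]; split => //; last by split; rlra.
  by have /rangeN/range_refl := r2; rewrite !opprK oppr0.
by have /rangeN/range_refl := r1; rewrite oppr0.
Qed.

Section Basics.
Variable h : R -> R.
Hypotheses (ch : continuous h) (h0 : h 0 = 0).

Lemma crossing0 x1 x2 m M w1 w2 : crossing h x1 x2 m M w1 w2 -> m <= 0 <= M.
Proof.
move=> [x10 x20 [r1 _ _] [r2 _ _] _].
have := r1 0; have := r2 0; rewrite h0; rlra.
Qed.

(* Before the second path first reaches y, it has stayed in [m, y]. *)
Lemma crossing_reach f x1 x2 m M w1 w2 y :
  subordinate f h -> crossing h x1 x2 m M w1 w2 -> 0 <= y <= w2 ->
  exists2 m', m <= m' <= 0 &
    forall lo hi, range_on f m' y lo hi -> chain (f \o -%R) lo hi.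
Proof.
move=> [_ sub] [x10 x20 r1 r2 w12] yw2.
have [r2b _ [x xx1 hx]] := r2.
have [|||tau [tau0 htau lt_tau]] := @first_hit _ (h \o -%R) (- x) y.
- exact: continuous_refl.
- rlra.
- by rewrite /= oppr0 opprK h0 hx.
have [//|m' [hi' rh]] := @range_exists _ (h \o -%R) 0 tau (continuous_refl ch) _; first rlra.
have [rhb [a a0 ha] [b b0 hb]] := rh.
have hi'y : hi' = y.
  have := rhb tau; rewrite htau /= -hb.
  have [/eqP ->|bt] := boolP (b == tau); first by rewrite htau; rlra.
  by have := lt_tau b; rewrite /= in bt * => hh hh'; move/eqP in bt; rlra.
have mm' : m <= m'.
  by rewrite -ha /=; have := r2b (- a); rlra.
have m'0 : m' <= 0.
  by have := rhb 0; rewrite /= oppr0 h0; rlra.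
exists m' => [|lo hi rf]; first by rewrite mm'.
apply: sub; exists tau; first rlra.
apply: (@range_comp _ f (h \o -%R) 0 tau m' y) => //.
- exact: continuous_refl.
- by rewrite -hi'y.
Qed.

End Basics.

Lemma range_max f b r : continuous f -> 0 <= b -> f b = r ->
  (forall x, 0 <= x < b -> f x < r) -> exists lo, range_on f 0 b lo r.
Proof.
move=> cf b0 fb ltb; have [lo [hi [h1 h2 [d d0 fd]]]] := range_exists cf b0.
exists lo; suff <- : hi = r by split => //; exists d.
have := h1 b; have := ltb d; have [db|] := eqVneq d b; first by move: fd; rewrite db; rlra.
by rewrite neq_lt => /orP; rlra.
Qed.

(** Just before [y2] the function already exceeds [q >= 0 >= lo], so only the maximum still grows
    there: the two ranges share the lower end [lo], as a [plateau_lo] asks. *)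
Lemma range_before_max f y y2 q q' : continuous f -> f 0 = 0 -> 0 <= q < q' -> 0 <= y < y2 ->
  f y2 = q' -> (forall x, 0 <= x < y2 -> f x < q') ->
  exists y1 lo v, [/\ y <= y1 < y2, q < v < q', range_on f 0 y1 lo v & range_on f 0 y2 lo q'].
Proof.
move=> cf f0 qq' yy2 fy2 lty2; have [|e e0 he] := @continuous_gt_ball _ f y2 q cf.
  by rewrite fy2; case/andP: qq'.
have [y1 [yy1 y12 y1e]] := approach_left (proj2 (andP yy2)) e0.
have fgt x : y1 <= x <= y2 -> q < f x.
  by move=> xy; apply: he; rewrite ltr_norml; rlra.
have [|lo [v [hy [b b0 fb] [c c0 fc]]]] := @range_exists _ f 0 y1 cf; first rlra.
have lo0 : lo <= 0 by have := hy 0; rewrite f0; rlra.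
exists y1, lo, v; split; first rlra.
- by apply/andP; split; [have := fgt y1; have := hy y1; rlra|rewrite -fc; apply: lty2; rlra].
- by split => //; [exists b|exists c].
split=> [x xy2||]; [|by exists b => //; rlra|by exists y2 => //; rlra].
case: (le_or_lt x y1) => x1; first by have := hy x; have := lty2 x; rlra.
have := fgt x; have := lty2 x.
have [->|] := eqVneq x y2; first rlra.
by rewrite neq_lt; rlra.
Qed.

(** By [crossing_reach] the left arm of [f] passes through the range of [f] on some [[m', y]]. On
    [[m', 0]], which lies in [[w1, M]], [f] keeps to [[p, q]] and so adds nothing to the range on
    [[0, y]]. *)
Lemma crossing_refl_chain f h x1 x2 m M w1 w2 p q y lo v :
  continuous h -> h 0 = 0 -> subordinate f h -> crossing h x1 x2 m M w1 w2 ->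
  range_on f w1 M p q -> lo <= p -> q < v -> 0 <= y <= w2 -> range_on f 0 y lo v ->
  chain (f \o -%R) lo v.
Proof.
move=> ch h0 sub cr [hU _ _] lop qv yw [hy [d d0 fd] [u u0 fu]].
have m0M := crossing0 h0 cr; have [m' mm' hm'] := crossing_reach ch h0 sub cr yw.
have w1m' : w1 <= m' by have [_ _ _ _ [_ w1m _ _]] := cr; rlra.
apply: hm'; split; [|by exists d => //; rlra|by exists u => //; rlra].
move=> x xx; case: (le_or_lt 0 x) => x0; first by apply: hy; rlra.
by have := hU x; rlra.
Qed.

(* If f went higher on [m, w2] than on [w1, M], both arms of f would pass over q
   with the same lower end, against twinlessness. *)
Lemma crossing_hi_le f h x1 x2 m M w1 w2 p q p' q' :
  continuous f -> continuous h -> f 0 = 0 -> h 0 = 0 -> twinless f ->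
  subordinate f h -> crossing h x1 x2 m M w1 w2 ->
  range_on f w1 M p q -> range_on f m w2 p' q' -> q' <= q.
Proof.
move=> cf ch f0 h0 nt sub cr rU rV; rewrite leNgt; apply/negP => qq'.
have m0M := crossing0 h0 cr.
have [x10 x20 r1 r2 [w10 w1m Mw2 w21]] := cr.
have [hU _ _] := rU.
have p0q : p <= 0 <= q by have := hU 0; rewrite f0; rlra.
have [_ _ [z zm fz]] := rV.
have Mz : M < z by rewrite ltNge; apply/negP => zM; have := hU z; rlra.
have [||y2 [y20 fy2 lty2]] := @first_hit _ f z q' cf; [rlra|rewrite f0 fz; rlra|].
(* [h] fills [[w1, M]] along the right arm, so [[p, q]] is already a range of [f] on some [[0, yU]];
   going beyond [yU] makes the lower end [lam] at most [p]. *)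
have [yU yU01 [hyU [a a0 fa] _]] : chain f p q.
  by apply: (proj1 sub); exists x2 => //; exact: range_comp r1 rU.
have yUy2 : yU < y2 by rewrite ltNge; apply/negP => y2yU; have := hyU y2; rlra.
have y2w2 : y2 <= w2 by rlra.
have [||y1 [lam [v [y1y2 v1 R1 R2]]]] := range_before_max cf f0 _ _ fy2 lty2 (q := q) (y := yU).
- rlra.
- rlra.
have lamp : lam <= p by rewrite -fa; have [h1 _ _] := R1; have := h1 a; rlra.
have {}refl := crossing_refl_chain ch h0 sub cr rU lamp.
have vq' : v < q' by rlra.
apply: (proj2 (nt lam)); split; exists v, q'; split => //.
- by exists y1 => //; rlra.
- by exists y2 => //; rlra.
- by apply: refl R1; rlra.
- by apply: refl R2; rlra.
Qed.

Lemma swap_continuous h : continuous h -> continuous (swap h).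
Proof. by move=> ch; apply: continuousN; exact: (continuous_refl ch). Qed.

(** Four instances of [crossing_hi_le]: the mirror image gives the reverse inequality for the upper
    ends, negation of [f] treats the lower ends. *)
Lemma crossing_range f h x1 x2 m M w1 w2 p q :
  continuous f -> continuous h -> f 0 = 0 -> h 0 = 0 -> twinless f ->
  subordinate f h -> crossing h x1 x2 m M w1 w2 ->
  range_on f w1 M p q -> range_on f m w2 p q.
Proof.
move=> cf ch f0 h0 nt sub cr rU.
have [_ _ _ _ [_ w1m Mw2 _]] := cr; have m0M := crossing0 h0 cr.
have [|p' [q' rV]] := @range_exists _ f m w2 cf; first rlra.
suff [-> ->] : p = p' /\ q = q' by [].
have cs := crossing_swap cr.
have sh0 : swap h 0 = 0 by rewrite /swap oppr0 h0 oppr0.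
have f0' : (f \o -%R) 0 = 0 by rewrite /= oppr0.
have n0 u : u = 0 :> R -> - u = 0 by move=> ->; rewrite oppr0.
have e1 := crossing_hi_le cf ch f0 h0 nt sub cr rU rV.
have e2 := crossing_hi_le (continuous_refl cf) (swap_continuous ch) f0' sh0
  (twinless_refl nt) (subordinate_refl sub) cs (range_refl rV) (range_refl rU).
have e3 := crossing_hi_le (continuousN cf) ch (n0 _ f0) h0 (twinlessN nt)
  (subordinateN sub) cr (rangeN rU) (rangeN rV).
have e4 := crossing_hi_le (continuousN (continuous_refl cf)) (swap_continuous ch)
  (n0 _ f0') sh0 (twinlessN (twinless_refl nt)) (subordinateN (subordinate_refl sub))
  cs (rangeN (range_refl rV)) (rangeN (range_refl rU)).
rlra.
Qed.

(** Otherwise [[p', r]] and the range of [f] on some [[m', y]], with [y] just before [b], are both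
    ranges of the left arm of [f]; the latter reaches down to [p < p'] but stays below [r], and
    ranges along an arm are nested. *)
Lemma crossing_first_hits f h x1 x2 m M w1 w2 a b p p' r :
  continuous f -> continuous h -> f 0 = 0 -> h 0 = 0 ->
  subordinate f h -> crossing h x1 x2 m M w1 w2 ->
  (forall x, m <= x <= M -> f x < r) -> 0 <= b <= w2 -> f b = r ->
  (forall x, 0 <= x < b -> f x < r) -> range_on f 0 b p r ->
  - 1 <= a < m -> range_on f a 0 p' r -> p' <= p.
Proof.
move=> cf ch f0 h0 sub cr ltr bw fb ltb rb am ra; rewrite leNgt; apply/negP => pp'.
have m0M := crossing0 h0 cr.
have r0 : 0 < r by rewrite -f0; apply: ltr.
have p0 : p <= 0 by have [hb _ _] := rb; have := hb 0; rewrite f0; rlra.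
have b0 : 0 < b by rewrite lt_neqAle; apply/andP; split; [apply/eqP => b'; move: fb; rewrite -b'|]; rlra.
have [|e e0 he] := @continuous_gt_ball _ f b 0 cf; first by rewrite fb.
have [y [y0 yb ye]] := approach_left b0 e0.
have fgt x : y <= x <= b -> 0 < f x.
  by move=> xy; apply: he; rewrite ltr_norml; rlra.
have [|m' mm' h3] := crossing_reach ch h0 sub cr (y := y); first rlra.
have [hb [z zb fz] _] := rb; have [ha _ [u ua fu]] := ra.
have zy : z < y by rewrite ltNge; apply/negP => yz; have := fgt z; rlra.
have [|lo [hi rm]] := @range_exists _ f m' y cf; first rlra.
have [hm [c cm fc] [d dm fd]] := rm.
have lop : lo = p.
  apply/eqP; rewrite eq_le; apply/andP; split; first by rewrite -fz; have := hm z; rlra.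
  rewrite -fc; case: (le_or_lt 0 c) => [c0|c0]; first by have := hb c; rlra.
  by have := ha c; rlra.
have hir : hi < r.
  rewrite -fd; case: (le_or_lt 0 d) => [d0|d0]; first by apply: ltb; rlra.
  by apply: ltr; rlra.
have ca : chain (f \o -%R) p' r.
  by exists (- a); [rlra|have /range_refl := ra; rewrite oppr0].
have := chain_le (h3 _ _ rm) ca; rlra.
Qed.

Lemma chain_plateau_lo f y p r : continuous f -> f 0 = 0 -> 0 < r -> 0 <= y <= 1 ->
  f y = r -> (forall x, 0 <= x < y -> f x < r) -> range_on f 0 y p r ->
  plateau_lo (chain f) p.
Proof.
move=> cf f0 r0 y01 fy lty ry; have [hy [z zy fz] _] := ry.
have zy' : z < y.
  rewrite lt_neqAle; apply/andP; split; last rlra.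
  by apply/eqP => zy'; have := hy 0; rewrite f0 -fz zy' fy; rlra.
have [|lo [hi rz]] := @range_exists _ f 0 z cf; first rlra.
have [hz [c cz fc] [d dz fd]] := rz.
have lop : lo = p.
  apply/eqP; rewrite eq_le; apply/andP; split; first by rewrite -fz; have := hz z; rlra.
  by rewrite -fc; have := hy c; rlra.
exists hi, r; split.
- by rewrite -fd; apply: lty; rlra.
- by exists z; [rlra|rewrite -lop].
- by exists y.
Qed.

(* If f < r on [m, M], each arm of f reaches r, but the chains of f force the
   two lower ends at that moment to be equal, against twinlessness. *)
Lemma crossing_attains f h x1 x2 m M w1 w2 p r :
  continuous f -> continuous h -> f 0 = 0 -> h 0 = 0 -> twinless f ->
  subordinate f h -> crossing h x1 x2 m M w1 w2 -> range_on f w1 M p r ->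
  exists2 x, m <= x <= M & f x = r.
Proof.
move=> cf ch f0 h0 nt sub cr rU; apply: contrapT => nex.
have rV := crossing_range cf ch f0 h0 nt sub cr rU.
have m0M := crossing0 h0 cr.
have [x10 x20 r1 r2 [w10 w1m Mw2 w21]] := cr.
have ltr x : m <= x <= M -> f x < r.
  move=> xm; rewrite lt_neqAle; apply/andP; split; last first.
    by have [hU _ _] := rU; have := hU x; rlra.
  by apply/eqP => fx; apply: nex; exists x.
have r0 : 0 < r by rewrite -f0; apply: ltr.
have [_ _ [z zm fz]] := rV; have [_ _ [u um fu]] := rU.
have z0 : 0 <= z.
  by rewrite leNgt; apply/negP => z0; have := ltr z; rlra.
have u0 : u <= 0.
  by rewrite leNgt; apply/negP => u0; have := ltr u; rlra.
have [||b [b0 fb ltb]] := @first_hit _ f z r cf; [rlra|rewrite f0 fz; rlra|].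
have [||a [a0 fa lta]] := @first_hit _ (f \o -%R) (- u) r (continuous_refl cf).
- rlra.
- by rewrite /= oppr0 opprK f0 fu; rlra.
have Mb : M < b by rewrite ltNge; apply/negP => bM; have := ltr b; rlra.
have am : - a < m by rewrite ltNge; apply/negP => ma; have := ltr (- a); move: fa => /=; rlra.
have [|lb rb] := range_max cf _ fb ltb; first rlra.
have [|la ra] := range_max (continuous_refl cf) _ fa lta; first rlra.
have rb' := range_refl rb; have /range_reflE := ra; rewrite oppr0 => ra'.
have e1 : la <= lb.
  by apply: (crossing_first_hits cf ch f0 h0 sub cr (a := - a) (b := b) (r := r)) => //; rlra.
have e2 : lb <= la.
  apply: (crossing_first_hits (continuous_refl cf) (swap_continuous ch) _ _
    (subordinate_refl sub) (crossing_swap cr) (a := - b) (b := a) (r := r)) => //.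
  - by rewrite /= oppr0.
  - by rewrite /swap oppr0 h0 oppr0.
  - by move=> x xm /=; apply: ltr; rlra.
  - rlra.
  - rlra.
  - by rewrite oppr0 in rb'.
have lab : la = lb by rlra.
apply: (proj2 (nt lb)); split; first by apply: (chain_plateau_lo cf f0 r0 _ fb ltb rb); rlra.
rewrite -lab; apply: (chain_plateau_lo (continuous_refl cf) _ r0 _ fa lta ra); last rlra.
by rewrite /= oppr0.
Qed.

End Crossings.

(** * Contour points *)

Section ContourStructure.
Variable R : realType.
Implicit Types (f g h s t G : R -> R) (alpha v : nat -> R) (i j k n : nat).
Implicit Types (a b c d e lo hi p q r x y z m M w : R).

Lemma departureP g x :
  departure g x <-> 0 < x <= 1 /\ forall y, 0 <= y < x -> g y <> g x.
Proof.
split=> -[x01 hx]; split.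
- by move: x01; rewrite in_itv.
- by move=> y yx gy; apply: hx; exists y => //=; rewrite in_itv.
- by rewrite in_itv.
- by move=> [y /= ]; rewrite in_itv => /hx.
Qed.

Lemma departureN g x : departure (fun x => - g x) x <-> departure g x.
Proof.
by rewrite !departureP; split=> -[x01 hx]; split => // y /hx gy gyx; apply: gy;
  [rewrite gyx|apply: oppr_inj].
Qed.

Lemma contour_pointN g x : contour_point (fun x => - g x) x <-> contour_point g x.
Proof.
rewrite /contour_point /opposite_orientation departureN.
split=> -[dx hx]; split => // y /[dup] /departureN dy dy' /hx [//|z [/departureN dz oz xz zy]];
  exists z; split => //; rlra.
Qed.

Lemma contour_point_eq f g x : (forall y, 0 <= y <= 1 -> f y = g y) ->
  contour_point f x -> contour_point g x.
Proof.
move=> fg; have dep y : departure f y <-> departure g y.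
  by rewrite !departureP; split=> -[y01 hy]; split => // z zy;
    move: (hy z zy); rewrite !fg //; rlra.
move=> [/dep dx hx]; split => // y /dep dy xy.
have [z [/dep dz oz xz zy]] := hx _ dy xy; exists z; split => //.
move: dx dy dz oz => /departureP[? _] /departureP[? _] /departureP[? _].
by rewrite /opposite_orientation !fg //; rlra.
Qed.

Section OneArm.
Variable g : R -> R.
Hypotheses (cg : continuous g) (g0 : g 0 = 0).

Lemma departure_neq0 x : departure g x -> g x <> 0.
Proof.
by move=> /departureP[x01 hx] gx; apply: (hx 0); rewrite ?g0 //; rlra.
Qed.

Lemma departure_gt0 x y : departure g x -> 0 < g x -> 0 <= y < x -> g y < g x.
Proof.
move=> /departureP[x01 hx] gx yx; rewrite ltNge; apply/negP => gyx.
have [||z z0 gz] := @ivt_between _ g 0 y (g x) cg; [rlra|by left; rewrite g0; rlra|].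
by apply: (hx z) => //; rlra.
Qed.

Lemma extremum_departure a : 0 < a <= 1 -> (forall y, 0 <= y < a -> g y < g a) ->
  departure g a.
Proof.
by move=> a01 ha; apply/departureP; split => // y /ha gy gya; move: gy; rewrite gya ltxx.
Qed.

End OneArm.

Lemma first_max g b : continuous g -> g 0 = 0 -> 0 <= b ->
  exists a, [/\ 0 <= a <= b, 0 <= g a, forall y, 0 <= y <= b -> g y <= g a &
                forall y, 0 <= y < a -> g y < g a].
Proof.
move=> cg g0 b0; have [c c0 hc] := attains_max cg b0.
have [||a [a0 ga lta]] := @first_hit _ g c (g c) cg; first rlra.
  by rewrite g0 lexx andbT -g0; apply: hc; rlra.
exists a; rewrite ga; split => //; first rlra.
by rewrite -g0; apply: hc; rlra.
Qed.

(** A departure between [a] and [b] cannot be positive, as its value would have been taken on the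
    way up to [a]; from [b] on, [b] itself is the required negative departure. *)
Lemma extremum_contour g a b : continuous g -> g 0 = 0 -> 0 < a < b -> b <= 1 ->
  (forall y, 0 <= y < a -> g y < g a) -> (forall y, 0 <= y <= b -> g y <= g a) ->
  g b < 0 -> (forall y, 0 <= y < b -> g b < g y) -> contour_point g a.
Proof.
move=> cg g0 ab b1 lta lea gb ltb.
have ga : 0 < g a by have := lta 0; rewrite g0; rlra.
split; first by apply: extremum_departure => //; rlra.
move=> x /[dup] dx /departureP[x01 hx] ax.
case: (le_or_lt b x) => [bx|xb].
  exists b; split => //; last rlra; last by left.
  by apply/departureN; apply: extremum_departure => [|y yb]; [rlra|rewrite ltrN2; exact: ltb].
exists x; split => //; left; split => //; rewrite ltNge; apply/negP => gx.
have [||z z0 gz] := @ivt_between _ g 0 a (g x) cg; first rlra.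
  by left; rewrite g0; have := lea x; rlra.
by apply: (hx z) => //; rlra.
Qed.

(** If [g] goes below 0 before [b], the first point where its minimum over [[0, b]] is attained is a
    contour point, with [b] as the opposite extremum after it. *)
Lemma contour_before g b : continuous g -> g 0 = 0 -> departure g b -> 0 < g b ->
  (forall y, 0 <= y <= b -> 0 <= g y) \/
  exists a, [/\ contour_point g a, 0 < a < b, g a < 0 &
    forall y, 0 <= y <= b -> g a <= g y].
Proof.
move=> cg g0 db gb; have /departureP[b01 hb] := db.
have n0 : - g 0 = 0 by rewrite g0 oppr0.
have b0 : 0 <= b by rlra.
have [a [a0 ga lea lta]] := first_max (continuousN cg) n0 b0.
case: (le_or_lt 0 (g a)) => [ga0|ga0]; [left|right].
  by move=> y /lea; rlra.
have ab : a <> b by move=> ab; move: gb; rewrite -ab; rlra.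
have a'0 : a <> 0 by move=> a'0; move: ga0; rewrite a'0 g0; rlra.
have a0' : 0 < a < b.
  by apply/andP; split; rewrite lt_neqAle; apply/andP; (split; [apply/eqP|]) => //; [exact: nesym|rlra|rlra].
exists a; split => //; last by move=> y /lea; rlra.
apply/contour_pointN; apply: (extremum_contour (continuousN cg) n0 a0') => //.
- rlra.
- by rewrite oppr_lt0.
- by move=> y yb; rewrite ltrN2; apply: departure_gt0.
Qed.

(* Used when b is a positively oriented contour point and a is the previous one,
   or 0. *)
Definition leg g a b e :=
  [/\ 0 < g b, g a <= 0 & forall x, 0 <= x <= e -> g a <= g x <= g b].

(** A negative minimum over [[0, b]] is attained at a contour point before [b]; as [a] is the last
    of these and a departure, that point is [a] itself. *)
Lemma leg_inner g a b : continuous g -> g 0 = 0 -> contour_point g b -> 0 < g b ->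
  a = 0 \/ contour_point g a -> a < b ->
  (forall x, contour_point g x -> x < b -> x <= a) -> leg g a b b.
Proof.
move=> cg g0 [db _] gb a0 ab gap; have /departureP[b01 hb] := db.
have le_b x : 0 <= x <= b -> g x <= g b.
  move=> xb; have [<- //|xb'] := eqVneq b x; apply/ltW/departure_gt0 => //.
  by rewrite lt_neqAle eq_sym xb'; rlra.
suff [ga h] : g a <= 0 /\ forall x, 0 <= x <= b -> g a <= g x.
  by split => // x xb; rewrite h // le_b.
case: a0 => [a0|[da ha]].
  rewrite a0 g0; split => // x xb.
  have [h|[c [/gap cc c0 _ _]]] := contour_before cg g0 db gb; first exact: h.
  by have := cc; rlra.
have /departureP[a01 ha'] := da.
have [y [dy oy ay yb]] := ha b db ab.
(* Were [a] positive too, the negative departure [y] between [a] and [b] would undercut the minimum,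
   which is attained at a contour point no later than [a]. *)
have ga : g a < 0.
  rewrite ltNge; apply/negP => ga; have ga0 := departure_neq0 g0 da.
  have gy : g y < 0 by case: oy; rlra.
  have yb' : y < b.
    by rewrite lt_neqAle yb andbT; apply/eqP => yb'; move: gy; rewrite yb'; rlra.
  have [h|[c [/gap cc c0 gc lec]]] := contour_before cg g0 db gb.
    by have /departureP[? _] := dy; have := h y; rlra.
  have ca : c <= a by apply: cc; rlra.
  have : - g c < - g y.
    apply: (@departure_gt0 (fun x => - g x)); rewrite ?g0 ?oppr0 //.
    - exact: continuousN.
    - exact/departureN.
    - rlra.
    - rlra.
  by have /departureP[? _] := dy; have := lec y; rlra.
split; first rlra.
have [h|[c [/gap cc c0 gc lec]]] := contour_before cg g0 db gb.
  by have := h a; rlra.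
have ca : c <= a by apply: cc; rlra.
have [<- //|ca'] := eqVneq c a.
have : - g c < - g a.
  apply: (@departure_gt0 (fun x => - g x)); rewrite ?g0 ?oppr0 //.
  - exact: continuousN.
  - exact/departureN.
  - rlra.
  - by rewrite lt_neqAle ca'; rlra.
by have := lec a; rlra.
Qed.

(** No departure comes after [z], the later of the first maximum and the first minimum on [[0, 1]].
    Hence [z > b] would be a departure without successors, vacuously a contour point. *)
Lemma leg_last g a b : continuous g -> g 0 = 0 -> contour_point g b ->
  (forall x, contour_point g x -> x <= b) -> leg g a b b -> leg g a b 1.
Proof.
move=> cg g0 [db hb] last [gb ga hab]; split => //.
have /departureP[b01 _] := db.
have n0 : - g 0 = 0 by rewrite g0 oppr0.
have [u [u0 gu leu ltu]] := first_max cg g0 ler01.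
have [l [l0 gl lel ltl]] := first_max (continuousN cg) n0 ler01.
pose z := Num.max u l.
have [zu zl z1] : [/\ u <= z, l <= z & z <= 1].
  by rewrite /z maxEle; case: ifP => ?; split; rlra.
have nodep x : departure g x -> x <= z.
  move=> /departureP[x01 hx]; rewrite leNgt; apply/negP => zx.
  have gx1 := leu x; have gx2 := lel x.
  case: (le_or_lt u l) => [ul|lu].
    have [||y y0 gy] := @ivt_between _ g u l (g x) cg; [rlra|by right; rlra|].
    by apply: (hx y) => //; rlra.
  have [||y y0 gy] := @ivt_between _ g l u (g x) cg; [rlra|by left; rlra|].
  by apply: (hx y) => //; rlra.
have zb : z <= b.
  rewrite leNgt; apply/negP => bz; have : departure g z.
    rewrite /z maxEle; case: ifP => ul; rewrite /z maxEle ul in bz.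
      apply/departureN; apply: extremum_departure => //; rlra.
    apply: extremum_departure => //; rlra.
  move=> dz; suff /last : contour_point g z by rlra.
  by split => // x /nodep; rlra.
move=> x x01; have := leu x x01; have := lel x x01.
by have := hab u; have := hab l; rlra.
Qed.

Definition contour_seq g alpha n :=
  [/\ (0 < n)%N, alpha 0%N = 0, forall i, (i < n)%N -> alpha i < alpha i.+1,
      forall i, (i < n)%N -> contour_point g (alpha i.+1)
    & forall x, contour_point g x -> exists2 i, (i < n)%N & x = alpha i.+1].

Lemma contour_seqN g alpha n :
  contour_seq g alpha n -> contour_seq (fun x => - g x) alpha n.
Proof.
move=> [n0 a0 inc cont all]; split => // [i /cont|x]; first by move/contour_pointN.
by move=> /contour_pointN /all.
Qed.

Lemma contour_seq_ltn g alpha n i j : contour_seq g alpha n ->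
  (i < j <= n)%N -> alpha i < alpha j.
Proof.
move=> [_ _ inc _ _] /andP[]; elim: j => // j IH; rewrite ltnS leq_eqVlt => /orP[/eqP ->|ij] jn.
  exact: inc.
by apply: lt_trans (inc _ jn); apply: IH => //; exact: ltnW.
Qed.

Lemma contour_seq_leq g alpha n i j : contour_seq g alpha n ->
  (i <= j <= n)%N -> alpha i <= alpha j.
Proof.
move=> cs /andP[]; rewrite leq_eqVlt => /orP[/eqP -> //|ij jn].
by apply/ltW/(contour_seq_ltn cs); rewrite ij.
Qed.

Lemma contour_factor_seq g t : contour_factor g t ->
  exists alpha n, [/\ contour_seq g alpha n,
    forall i, (i <= n)%N -> t (i%:R / n%:R) = g (alpha i) &
    forall i, (i < n)%N -> affine_on (i%:R / n%:R) (i.+1%:R / n%:R) t].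
Proof.
move=> [s [srt mem n0 val aff]]; exists (nth 0 (0 :: s)), (size s); split => //.
have contour_s i : (i < size s)%N -> contour_point g (nth 0 s i).
  by move=> ilt; apply/mem; rewrite mem_nth.
split => //.
- move=> i ilt; case: i ilt => [|i] ilt /=.
    by have [/departureP[]] := contour_s _ ilt; case/andP.
  by apply: (sorted_ltn_nth lt_trans 0 srt) => //; rewrite inE //; exact: ltnW.
- move=> x /mem xs; exists (index x s); first by rewrite index_mem.
  by rewrite /= nth_index.
Qed.

(** After the last contour point [g] takes no new values, so the last leg is prolonged to the end of
    the arm. *)
Definition leg_end alpha n i := if i.+1 == n then 1 else alpha i.+1.

Lemma contour_seq_leg g alpha n i : continuous g -> g 0 = 0 ->
  contour_seq g alpha n -> (i < n)%N ->
  leg g (alpha i) (alpha i.+1) (leg_end alpha n i) \/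
  leg (fun x => - g x) (alpha i) (alpha i.+1) (leg_end alpha n i).
Proof.
have pos f : continuous f -> f 0 = 0 -> contour_seq f alpha n -> (i < n)%N ->
  0 < f (alpha i.+1) -> leg f (alpha i) (alpha i.+1) (leg_end alpha n i).
  move=> cf f0 cs ilt fi; have [n0 a0 inc cont all] := cs.
  have inner : leg f (alpha i) (alpha i.+1) (alpha i.+1).
    apply: leg_inner => //.
    - exact: cont.
    - by case: (i) ilt => [|j] jlt; [left|right; apply: cont; exact: ltnW].
    - exact: inc.
    - move=> x /all [j jn ->] jlt; apply: (contour_seq_leq cs); rewrite (ltnW ilt) andbT.
      rewrite leqNgt; apply/negP => ij.
      have : alpha i.+1 <= alpha j.+1 by apply: (contour_seq_leq cs); rewrite ij.
      by rewrite leNgt jlt.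
  rewrite /leg_end; case: eqP => [iN|//]; apply: leg_last => //; first exact: cont.
  move=> x /all [j jn ->]; apply: (contour_seq_leq cs).
  by rewrite iN jn leqnn.
move=> cg g0 cs ilt; have [_ _ _ cont _] := cs.
have := departure_neq0 g0 (proj1 (cont i ilt)).
have [gi|gi|] := ltgtP (g (alpha i.+1)) 0 => // _; [right|by left; apply: pos].
apply: pos => //; [exact: continuousN|by rewrite g0 oppr0|exact: contour_seqN|rlra].
Qed.

End ContourStructure.

(** * Lifts through contour factors *)

Section Lifts.
Variable R : realType.
Implicit Types (f g h s t G : R -> R).
Implicit Types (a b c d lo hi p q r v x y z m M w : R).

(** Of the two final ends, the one reached first is the plateau: it rests until the other is
    reached. *)
Lemma chain_plateau f p q : continuous f -> f 0 = 0 -> chain f p q -> p < q ->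
  plateau_lo (chain f) p \/ plateau_hi (chain f) q.
Proof.
move=> cf f0 [y y01 ry] pq; have [hy [a ay fa] [b b_y fb]] := ry.
have p0q : p <= 0 <= q by have := hy 0; rewrite f0; rlra.
have [||u [u0 fu ltu]] := @first_hit _ f b q cf; [rlra|by rewrite f0 fb; rlra|].
have [||l [l0 fl ltl]] := @first_hit _ (fun x => - f x) a (- p) (continuousN cf).
- rlra.
- by rewrite f0 fa; rlra.
have fl' : f l = p by rlra.
have chu z : 0 <= z < u -> exists lo hi, [/\ range_on f 0 z lo hi, hi < q & p <= lo].
  move=> zu; have [|lo [hi rz]] := @range_exists _ f 0 z cf; first rlra.
  exists lo, hi; have [_ [c cz fc] [d dz fd]] := rz; split => //.
    by rewrite -fd; apply: ltu; rlra.
  by rewrite -fc; have := hy c; rlra.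
case: (le_or_lt u l) => [ul|lu]; [right|left]; last first.
  have [|lo [hi [rz hq plo]]] := chu l; first rlra.
  exists hi, q; split => //; last by exists y.
  exists l; first rlra.
  suff <- : lo = p by [].
  by have [hz _ _] := rz; have := hz l; rlra.
have [|lo [hi rz]] := @range_exists _ f 0 u cf; first rlra.
have [hz [c cz fc] [d dz fd]] := rz.
have hiq : hi = q by have := hz u; have := hy d; rlra.
exists p, lo; split; last by exists u; [rlra|rewrite -hiq].
  rewrite -fc -ltrN2; apply: ltl; rewrite lt_neqAle andbA.
  suff : c != l by move=> ->; rlra.
  apply/eqP => cl.
  have ul' : u = l by rlra.
  by move: fu; rewrite ul'; rlra.
by exists y.
Qed.

(* If the range of g has stalled while a lift keeps moving, the lift has just
   turned at an inner contour point. *)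
Definition turns_at_plateaus g s := forall x x' p q, 0 <= x < x' -> x' <= 1 ->
  range_on g 0 x p q -> range_on g 0 x' p q -> (forall y, 0 <= y <= x -> s y < s x') ->
  [/\ p < q, plateau_hi (chain g) q & plateau_lo (chain g) p].

(** Each tip has passed the whole of the other arm, the left tip upwards and the right tip
    downwards; nothing is asked of a tip relative to its own arm. *)
Definition negative_departure G x1 x2 :=
  (forall y, 0 <= y <= x2 -> G y < G (- x1)) /\
  (forall y, 0 <= y <= x1 -> G x2 < G (- y)).

Definition unit_map f := forall x, - 1 <= x <= 1 -> - 1 <= f x <= 1.

Section Composition.
Variables (f g h : R -> R).
Hypotheses (cf : continuous f) (cg : continuous g) (ch : continuous h).
Hypotheses (f0 : f 0 = 0) (g0 : g 0 = 0) (h0 : h 0 = 0).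
Hypotheses (ug : unit_map g) (uh : unit_map h) (ntf : twinless f) (ntg : twinless g).
Hypotheses (subfg : subordinate f g) (subgh : subordinate g h).

Lemma range_glue a b c d p q : a <= c <= b -> c <= d -> b <= d ->
  range_on f a b p q -> range_on f c d p q -> range_on f a d p q.
Proof.
move=> acb cd bd [h1 [x xab fx] [y yab fy]] [h2 _ _]; split.
- move=> z zad; case: (le_or_lt z b) => zb; [apply: h1|apply: h2]; rlra.
- by exists x => //; rlra.
- by exists y => //; rlra.
Qed.

Lemma range_hi_eq a b p q x : range_on g a b p q -> a <= x <= b ->
  (forall y, a <= y <= b -> g y <= g x) -> q = g x.
Proof.
move=> [h1 _ [y yab gy]] xab hx; have := h1 x xab; have := hx y yab; rlra.
Qed.

Lemma range_lo_eq a b p q x : range_on g a b p q -> a <= x <= b ->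
  (forall y, a <= y <= b -> g x <= g y) -> p = g x.
Proof.
move=> [h1 [y yab gy] _] xab hx; have := h1 x xab; have := hx y yab; rlra.
Qed.

(** Two crossings in a row. By [crossing_attains] for [h], [g] attains [p] and [r] on [[m, M]], and
    [r] even on [[m, 0]]. If it attains [p] there too, it maps [[m, 0]] onto [[p, r]]; otherwise [g]
    itself has a crossing, and [crossing_range] for [f] and [g] equates the ranges. *)
Lemma crossing_image x1 x2 m M w1 w2 p r : crossing h x1 x2 m M w1 w2 ->
  range_on g w1 M p r -> (forall x, 0 <= x <= M -> g x <> r) ->
  exists P Q, range_on f p r P Q /\ range_on (f \o g) m 0 P Q.
Proof.
move=> cr rJ noR; have m0M := crossing0 h0 cr.
have rJ' := crossing_range cg ch g0 h0 ntg subgh cr rJ.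
have [xr xrm gxr] := crossing_attains cg ch g0 h0 ntg subgh cr rJ.
have [xp xpm gxp] : exists2 x, m <= x <= M & g x = p.
  have [|x xm gx] := crossing_attains (continuousN cg) ch _ h0 (twinlessN ntg)
    (subordinateN subgh) cr (rangeN rJ); first by rewrite g0 oppr0.
  by exists x => //; rlra.
have {cr rJ rJ' noR} [bd gJ noR] : [/\ - 1 <= m /\ M <= 1,
    forall x, m <= x <= M -> p <= g x <= r & forall x, 0 <= x <= M -> g x < r].
  have [_ _ _ _ [w10 w1m Mw2 w21]] := cr; have [gJ _ _] := rJ; split; first rlra.
    by move=> x xm; apply: gJ; rlra.
  move=> x xM; rewrite lt_neqAle; apply/andP; split; first by apply/eqP/noR.
  by have := gJ x; rlra.
have xr0 : xr <= 0 by rewrite leNgt; apply/negP => xr0; have := noR xr; rlra.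
have [|nu [eta rnu]] := @range_exists _ g m 0 cg; first rlra.
have etar : eta = r.
  by rewrite -gxr; apply: (range_hi_eq rnu) => [|y ym]; [rlra|have := gJ y; rlra].
rewrite {}etar in rnu.
have [hnu [c cm gc] _] := rnu.
have g00 := hnu 0; rewrite g0 in g00.
have pnu : p <= nu by rewrite -gc; have := gJ c; rlra.
case: (le_or_lt nu p) => nup.
  have nuE : nu = p by rlra.
  have [|P [Q rI]] := @range_exists _ f p r cf; first rlra.
  by exists P, Q; split => //; apply: range_comp cg rnu _; rewrite nuE.
have xp0 : 0 <= xp.
  by rewrite leNgt; apply/negP => xp0; have := hnu xp; rlra.
have [|mu [rho rmu]] := @range_exists _ g 0 M cg; first rlra.
have mup : mu = p.
  by rewrite -gxp; apply: (range_lo_eq rmu) => [|y ym]; [rlra|have := gJ y; rlra].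
rewrite {}mup in rmu.
have [hmu _ [e em ge]] := rmu.
have rhor : rho < r by rewrite -ge; apply: noR.
have r1 : r <= 1 by rewrite -gxr; have := ug (x := xr); rlra.
have p1 : - 1 <= p by rewrite -gxp; have := ug (x := xp); rlra.
have g01 := hmu 0; rewrite g0 in g01.
(* In this crossing of [g] the right arm is [[0, M]], with range [[p, rho]], and the left arm is
   [[m, 0]], with range [[nu, r]]. *)
have cr' : crossing g (- m) M nu rho p r.
  by split; rewrite ?opprK //; rlra.
have [|P [Q rI]] := @range_exists _ f p rho cf; first rlra.
have rI' := crossing_range cf cg f0 g0 ntf subfg cr' rI.
exists P, Q; split; last exact: range_comp cg rnu rI'.
by apply: range_glue rI rI'; rlra.
Qed.

(** A positive value of [sigma] forces [w'] to the right, as [sigma] is at most 0 on the left;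
    exceeding all of [sigma] on [[0, M]], it lies beyond [M]. This confines [w] to the left, beyond
    [m]. *)
Lemma negative_departure_crossing sigma x1 x2 :
  sigma 0 = 0 -> (forall x, 0 <= x <= 1 -> sigma (- x) <= 0) ->
  0 <= x1 <= 1 -> 0 <= x2 <= 1 -> negative_departure (sigma \o h) x1 x2 ->
  exists m M w1 w2 w w', [/\ crossing h x1 x2 m M w1 w2, w1 <= w < m, M < w' <= w2,
    forall v, 0 <= v <= M -> sigma v < sigma w' &
    forall v, m <= v <= 0 -> sigma w < sigma v].
Proof.
move=> sg0 sgN x10 x20 [/= dep1 dep2].
have [w hw] : {w | w = h x2} by exists (h x2).
have [w' hw'] : {w' | w' = h (- x1)} by exists (h (- x1)).
have [|w1 [M r1]] := @range_exists _ h 0 x2 ch; first by case/andP: x20.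
have [|m [w2 r2]] := @range_exists _ h (- x1) 0 ch; first by rewrite oppr_le0; case/andP: x10.
have [h01 hww] : w1 <= 0 <= M /\ w1 <= w <= M.
  by have [hr _ _] := r1; rewrite -{1 2}h0 hw; split; apply: hr; case/andP: x20 => -> _; rewrite lexx.
have [h02 hww'] : m <= 0 <= w2 /\ m <= w' <= w2.
  by have [hr _ _] := r2; rewrite -{1 2}h0 hw'; split; apply: hr; rewrite oppr_le0;
    case/andP: x10 => -> _; rewrite lexx.
have [w11 M1] : - 1 <= w1 /\ M <= 1.
  by apply: range_bounds r1 _ => x xx; apply: uh; rlra.
have [m1 w21] : - 1 <= m /\ w2 <= 1.
  by apply: range_bounds r2 _ => x xx; apply: uh; rlra.
have {}dep1 v : 0 <= v <= M \/ w1 <= v <= 0 -> sigma v < sigma w'.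
  move=> v1; have [|y y0 <-] := range_onto (v := v) ch r1; first by case: v1; rlra.
  by rewrite hw'; exact: dep1.
have {}dep2 v : m <= v <= 0 \/ 0 <= v <= w2 -> sigma w < sigma v.
  move=> v1; have [|y y0 <-] := range_onto (v := v) ch r2; first by case: v1; rlra.
  by rewrite hw -[y]opprK; apply: dep2; rlra.
have w'0 : 0 < w'.
  rewrite ltNge; apply/negP => w'0; have : sigma (- - w') <= 0 by apply: sgN; rlra.
  by rewrite opprK leNgt -sg0 dep1 //; left; case/andP: h01 => _ ->; rewrite lexx.
have Mw' : M < w'.
  rewrite ltNge; apply/negP => w'M; suff : sigma w' < sigma w' by rewrite ltxx.
  by apply: dep1; left; rewrite w'M ltW.
have w0 : w < 0.
  rewrite ltNge; apply/negP => w0; suff : sigma w < sigma w by rewrite ltxx.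
  by apply: dep2; right; rlra.
have wm : w < m.
  rewrite ltNge; apply/negP => mw; suff : sigma w < sigma w by rewrite ltxx.
  by apply: dep2; left; rewrite mw ltW.
exists m, M, w1, w2, w, w'; split.
- by split => //; split => //; rlra.
- by case/andP: hww => -> _.
- by case/andP: hww' => _ ->; rewrite Mw'.
- by move=> v v0; apply: dep1; left.
- by move=> v v0; apply: dep2; left.
Qed.

(* sigma follows s \o g on the right arm, and on the left arm the lift s' of
   f \o g which, unlike s \o g, stays on the left.  With s \o g on both arms the
   conclusion fails, and so it does with side-preserving lifts on both. *)
Lemma no_negative_departure s s' sigma x1 x2 :
  s 0 = 0 -> (forall x, - 1 <= x <= 0 -> s x <= 0) ->
  (forall x, 0 <= x <= 1 -> 0 <= s' x) -> turns_at_plateaus (f \o g \o -%R) s' ->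
  (forall x, 0 <= x <= 1 -> sigma x = s (g x)) ->
  (forall x, 0 <= x <= 1 -> sigma (- x) = - s' x) ->
  0 <= x1 <= 1 -> 0 <= x2 <= 1 -> ~ negative_departure (sigma \o h) x1 x2.
Proof.
move=> s0 s_le0 s'_ge0 turns sr sl x10 x20 dep.
have sg0 : sigma 0 = 0 by rewrite sr ?g0 ?s0 // lexx ler01.
have sgN x : 0 <= x <= 1 -> sigma (- x) <= 0.
  by move=> x01; rewrite sl // oppr_le0; exact: s'_ge0.
have [m [M [w1 [w2 [w [w' [cr w1m Mw' dep1 dep2]]]]]]] :=
  negative_departure_crossing sg0 sgN x10 x20 dep.
have [_ _ r1 _ [w11 _ _ w21]] := cr; have m0M := crossing0 h0 cr.
have [|p [r rJ]] := @range_exists _ g w1 M cg; first rlra.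
have rJ' := crossing_range cg ch g0 h0 ntg subgh cr rJ.
(* On the right [sigma] is [s \o g]. If [g] attained [r] on [[0, M]], it would also attain [g w'],
   which lies in []0, r]], at some [v] there, and [sigma v = sigma w']. *)
have noR x : 0 <= x <= M -> g x <> r.
  move=> x0 gx; have w'01 : 0 <= w' <= 1 by rlra.
  have sgw : sigma w' = s (g w') by exact: sr.
  have w'1 : - 1 <= g w' <= 1 by apply: ug; rlra.
  have w'r : g w' <= r by have [gJ _ _] := rJ'; have := gJ w'; rlra.
  have sw'0 : 0 < sigma w' by rewrite -sg0; apply: dep1; rlra.
  have gw'0 : 0 < g w'.
    by rewrite ltNge; apply/negP => gw'0; move: sw'0; rewrite sgw ltNge s_le0 // gw'0; case/andP: w'1 => ->.
  have [||v v0 gv] := @ivt_between _ g 0 x (g w') cg; first by case/andP: x0.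
    by left; rewrite g0 gx w'r ltW.
  suff : sigma v < sigma w' by rewrite sgw sr ?gv ?ltxx //; rlra.
  by apply: dep1; rlra.
have [P [Q [rI rm]]] := crossing_image cr rJ noR.
have rw : range_on (f \o g) w 0 P Q.
  have [hI _ _] := rI; have [_ [i1 i10 fi1] [i2 i20 fi2]] := rm; have [gJ _ _] := rJ.
  split; [|by exists i1 => //; rlra|by exists i2 => //; rlra].
  by move=> x xw /=; apply: hI; apply: gJ; rlra.
(* From [m] to [w] the range of [f \o g] stalls although [s'] exceeds all its earlier values, so the
   left arm has plateaus at both [P] and [Q]. *)
have [| | | | |PQ hQ hP] := turns (- m) (- w) P Q.
- rlra.
- rlra.
- by have /range_refl := rm; rewrite oppr0.
- by have /range_refl := rw; rewrite oppr0.
- move=> y ym; have := sl (- w); rewrite opprK => slw.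
  rewrite -ltrN2 -slw; last rlra.
  by rewrite -sl; [apply: dep2; rlra|rlra].
have cQ : plateau_hi (chain (f \o -%R)) Q.
  by have [q1 [q2 [q12 h1 h2]]] := hQ; exists q1, q2; split => //; apply: (proj2 subfg).
have cP : plateau_lo (chain (f \o -%R)) P.
  by have [q1 [q2 [q12 h1 h2]]] := hP; exists q1, q2; split => //; apply: (proj2 subfg).
(* The right arm of [f] also passes through [[P, Q]], hence pauses at one of these ends: a twin. *)
have [y y0 ry] : chain g p r.
  by apply: (proj1 subgh); exists x2 => //; exact: range_comp r1 rJ.
have chf : chain f P Q.
  by apply: (proj1 subfg); exists y => //; exact: range_comp ry rI.
have [nt1 _] := ntf Q; have [_ nt2] := ntf P.
by case: (chain_plateau cf f0 chf PQ) => hh; [apply: nt2|apply: nt1].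
Qed.

End Composition.

End Lifts.

(** * Piecewise-linear interpolation *)

Section Interpolation.
Variable R : realType.
Implicit Types (f g h s t G : R -> R) (alpha tau v phi : nat -> R) (i j k n : nat).
Implicit Types (a b c d e lo hi p q u x y z m M w : R).

Lemma continuous_maxr (T : topologicalType) (f g : T -> R) :
  continuous f -> continuous g -> continuous (fun x : T => Num.max (f x) (g x)).
Proof. by move=> cf cg x; apply: (@continuous_max R T f g x); [exact: cf|exact: cg]. Qed.

Lemma continuous_minr (T : topologicalType) (f g : T -> R) :
  continuous f -> continuous g -> continuous (fun x : T => Num.min (f x) (g x)).
Proof. by move=> cf cg x; apply: (@continuous_min R T f g x); [exact: cf|exact: cg]. Qed.

Definition clamp01 u : R := Num.max 0 (Num.min 1 u).

Lemma clamp01P u : u <= 0 /\ clamp01 u = 0 \/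
  0 <= u <= 1 /\ clamp01 u = u \/ 1 <= u /\ clamp01 u = 1.
Proof.
by rewrite /clamp01 minEle; case: ifP => ?; rewrite maxEle; case: ifP => ?; rlra.
Qed.

Lemma clamp01_id u : 0 <= u <= 1 -> clamp01 u = u.
Proof. by case: (clamp01P u); rlra. Qed.

Lemma clamp01_le0 u : u <= 0 -> clamp01 u = 0.
Proof. by case: (clamp01P u); rlra. Qed.

Lemma clamp01_ge1 u : 1 <= u -> clamp01 u = 1.
Proof. by case: (clamp01P u); rlra. Qed.

Lemma clamp01_mono u w : u <= w -> clamp01 u <= clamp01 w.
Proof. by have := clamp01P u; have := clamp01P w; rlra. Qed.

Lemma clamp01_lt u w : u < w -> u < 1 -> 0 < w -> clamp01 u < clamp01 w.
Proof. by have := clamp01P u; have := clamp01P w; rlra. Qed.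

Lemma continuous_clamp01 (T : topologicalType) (f : T -> R) :
  continuous f -> continuous (fun x : T => clamp01 (f x)).
Proof.
move=> cf; apply: continuous_maxr; first by move=> ?; exact: cvg_cst.
by apply: continuous_minr => // ?; exact: cvg_cst.
Qed.

(* Starting at v 0, the i-th step has been climbed from v i to v i.+1 up to the
   fraction phi i. *)
Definition ladder v phi n := v 0%N + \sum_(i < n) (v i.+1 - v i) * phi i.

Lemma ladder_top v phi n : (forall i, (i < n)%N -> phi i = 1) -> ladder v phi n = v n.
Proof.
rewrite /ladder; elim: n => [|n IH] h1; first by rewrite big_ord0 addr0.
rewrite big_ord_recr /= addrA IH ?h1 ?mulr1 //; first by rlra.
by move=> i ilt; apply: h1; exact: ltnW.
Qed.

Lemma ladder_cell v phi n k : (k < n)%N -> (forall i, (i < k)%N -> phi i = 1) ->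
  (forall i, (k < i < n)%N -> phi i = 0) ->
  ladder v phi n = v k + (v k.+1 - v k) * phi k.
Proof.
move=> + h1; elim: n => // n IH kn h0; rewrite /ladder big_ord_recr /= addrA.
move: kn; rewrite ltnS leq_eqVlt => /orP[/eqP kn|kn].
  by rewrite -kn; congr (_ + _); apply: ladder_top.
rewrite (h0 n) ?kn ?ltnSn // mulr0 addr0; apply: IH => // i /andP[ki ilt].
by apply: h0; rewrite ki ltnW.
Qed.

Lemma continuous_ladder (T : topologicalType) v (phi : nat -> T -> R) n :
  (forall i, (i < n)%N -> continuous (phi i)) -> continuous (fun x : T => ladder v (phi ^~ x) n).
Proof.
elim: n => [|n IH] cphi.
  have -> : (fun x : T => ladder v (phi ^~ x) 0) = fun=> v 0%N.
    by apply/funext => x; rewrite /ladder big_ord0 addr0.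
  by move=> ?; exact: cvg_cst.
have -> : (fun x : T => ladder v (phi ^~ x) n.+1) =
    fun x : T => ladder v (phi ^~ x) n + (v n.+1 - v n) * phi n x.
  by apply/funext => x; rewrite /ladder big_ord_recr addrA.
move=> x; apply: cvgD; first by apply: IH => i ilt; apply: cphi; exact: ltnW.
by apply: cvgM; [exact: cvg_cst|exact: cphi].
Qed.

(** Piecewise-linear interpolation as a sum of clamped ramps: continuity comes without gluing, and
    the function is constant outside the knots. *)
Definition interp tau v n x :=
  ladder v (fun i => clamp01 ((x - tau i) / (tau i.+1 - tau i))) n.

Lemma continuous_interp tau v n : continuous (interp tau v n).
Proof.
apply: continuous_ladder => i _; apply: continuous_clamp01 => x.
by apply: cvgM; [apply: cvgB; [exact: cvg_id|exact: cvg_cst]|exact: cvg_cst].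
Qed.

Definition knots tau n := forall i, (i < n)%N -> tau i < tau i.+1.

Lemma knots_lt tau n i j : knots tau n -> (i < j <= n)%N -> tau i < tau j.
Proof.
move=> inc /andP[]; elim: j => // j IH; rewrite ltnS leq_eqVlt => /orP[/eqP ->|ij] jn.
  exact: inc.
by apply: lt_trans (inc _ jn); apply: IH => //; exact: ltnW.
Qed.

Lemma knots_le tau n i j : knots tau n -> (i <= j <= n)%N -> tau i <= tau j.
Proof.
move=> cs /andP[]; rewrite leq_eqVlt => /orP[/eqP -> //|ij jn].
by apply/ltW/(knots_lt cs); rewrite ij.
Qed.

Lemma knots_cell tau n x : (0 < n)%N -> tau 0%N <= x ->
  exists k, [/\ (k < n)%N, tau k <= x & (k.+1 < n)%N -> x < tau k.+1].
Proof.
move=> n0 x0.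
have exk : exists k, (k < n)%N && (tau k <= x) by exists 0%N; rewrite n0.
have bound k : (k < n)%N && (tau k <= x) -> (k <= n)%N by case/andP => /ltnW.
case: (ex_maxnP exk bound) => k /andP[kn kx] kmax; exists k; split => // kn'.
rewrite ltNge; apply/negP => kx'; have := kmax k.+1; rewrite kn' kx' ltnn => /(_ isT).
by [].
Qed.

Lemma interp_cell tau v n k x : knots tau n -> (k < n)%N -> tau k <= x <= tau k.+1 ->
  interp tau v n x = v k + (v k.+1 - v k) * ((x - tau k) / (tau k.+1 - tau k)).
Proof.
move=> inc kn xk; have d i : (i < n)%N -> 0 < tau i.+1 - tau i.
  by move=> /inc; rewrite subr_gt0.
rewrite /interp (@ladder_cell _ _ _ k) //.
- congr (_ + _ * _); apply: clamp01_id.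
  by rewrite ler_pdivlMr ?ler_pdivrMr ?d//; rlra.
- move=> i ik; apply: clamp01_ge1; have ilt := ltn_trans ik kn.
  have : tau i.+1 <= tau k by apply: (knots_le inc); rewrite ik ltnW.
  by rewrite ler_pdivlMr ?d//; rlra.
- move=> i /andP[ki ilt]; apply: clamp01_le0.
  have : tau k.+1 <= tau i by apply: (knots_le inc); rewrite ki ltnW.
  by rewrite ler_pdivrMr ?d//; rlra.
Qed.

Lemma interp_top tau v n x : knots tau n -> tau n <= x -> interp tau v n x = v n.
Proof.
move=> inc xn; apply: ladder_top => i ilt; apply: clamp01_ge1.
have : tau i.+1 <= tau n by apply: (knots_le inc); rewrite ilt leqnn.
by rewrite ler_pdivlMr ?subr_gt0 ?inc//; rlra.
Qed.

Lemma interp_between tau v n k x : knots tau n -> (k < n)%N -> tau k <= x <= tau k.+1 ->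
  exists2 lam, 0 <= lam <= 1 & interp tau v n x = v k + (v k.+1 - v k) * lam.
Proof.
move=> inc kn xk; exists ((x - tau k) / (tau k.+1 - tau k)); last exact: interp_cell.
have d : 0 < tau k.+1 - tau k by rewrite subr_gt0 inc.
by rewrite ler_pdivlMr ?ler_pdivrMr//; rlra.
Qed.

(** The two sums are compared term by term; the ramp of the cell containing [x] makes the inequality
    strict. *)
Lemma interp_lt tau v n x y : knots tau n -> knots v n -> tau 0%N <= x < y ->
  x < tau n -> interp tau v n x < interp tau v n y.
Proof.
move=> itau iv xy xn; have n0 : (0 < n)%N.
  by case: n xn {itau iv} => // ; rlra.
have [k [kn kx xk]] := knots_cell n0 (proj1 (andP xy)).
have xk1 : x < tau k.+1.
  have [/xk //|] := boolP (k.+1 < n)%N.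
  by rewrite -leqNgt => nk; have <- : n = k.+1 by apply/eqP; rewrite eqn_leq nk kn.
have d i : (i < n)%N -> 0 < tau i.+1 - tau i by move=> /itau; rewrite subr_gt0.
have dv i : (i < n)%N -> 0 < v i.+1 - v i by move=> /iv; rewrite subr_gt0.
rewrite /interp /ladder ltrD2l (bigD1 (Ordinal kn)) //= [ltRHS](bigD1 (Ordinal kn)) //=.
apply: ltr_leD; last first.
  apply: ler_sum => i _; rewrite ler_pM2l ?dv//; apply: clamp01_mono.
  by rewrite ler_pM2r ?invr_gt0 ?d//; rlra.
rewrite ltr_pM2l ?dv//; apply: clamp01_lt.
- by rewrite ltr_pM2r ?invr_gt0 ?d//; rlra.
- by rewrite ltr_pdivrMr ?d//; rlra.
- by rewrite ltr_pdivlMr ?d//; rlra.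
Qed.

End Interpolation.

(** * Lifts along one arm *)

Section Lifting.
Variable R : realType.
Implicit Types (f g h s t G : R -> R) (alpha tau v phi : nat -> R) (i j k n : nat).
Implicit Types (a b c d e lo hi p q u x y z m M w : R).

Definition lifting g t s :=
  [/\ continuous s, s 0 = 0, forall x, 0 <= x <= 1 -> 0 <= s x <= 1 /\ t (s x) = g x,
      exists2 x, 0 <= x <= 1 & s x = 1 & turns_at_plateaus g s].

(** The maximum [q] was attained before [alpha k], so [q = g (alpha j)] for the preceding contour
    point, and [p = g (alpha k)]. The range has upper end [q] from [alpha j] to [alpha k] and lower
    end [p] from [alpha k] to [alpha k.+1]: two plateaus. *)
Lemma leg_stall g alpha n k x x' p q : continuous g -> g 0 = 0 ->
  contour_seq g alpha n -> (k < n)%N ->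
  leg g (alpha k) (alpha k.+1) (leg_end alpha n k) ->
  alpha k <= x < x' -> x' <= leg_end alpha n k ->
  range_on g 0 x p q -> range_on g 0 x' p q ->
  (forall y, alpha k <= y <= x -> g y < g x') ->
  [/\ p < q, plateau_hi (chain g) q & plateau_lo (chain g) p].
Proof.
move=> cg g0 cs kn [gk1 gk hk] xx' x'e rx rx' lt_x'.
have [n0 a0 inc cont all] := cs.
have ak0 : 0 <= alpha k.
  by rewrite -a0; apply: (contour_seq_leq cs); rewrite /= ltnW.
have [hx _ [y y0 gy]] := rx; have [hx' [l l0 gl] _] := rx'.
have yk : y < alpha k.
  by rewrite ltNge; apply/negP => ky; have := lt_x' y; have := hx' x'; rlra.
have [j kj] : exists j, k = j.+1.
  by case: (k) yk => [|j]; [rewrite a0; rlra|exists j].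
have jn : (j < n)%N by apply: leq_trans kn; rewrite kj.
have [dk _] := cont _ jn; rewrite -kj in dk.
have gk0 : g (alpha k) < 0 by have := departure_neq0 g0 dk; rlra.
have [leg_j|[_ gj hj]] := contour_seq_leg cg g0 cs jn.
  by case: leg_j; rewrite -kj; rlra.
have ej : leg_end alpha n j = alpha k by rewrite /leg_end -kj ltn_eqF.
rewrite ej -kj in hj.
have jk : alpha j < alpha k by rewrite kj; apply: inc.
have aj0 : 0 <= alpha j.
  by rewrite -a0; apply: (contour_seq_leq cs); rewrite /= ltnW.
have qE : q = g (alpha j) by have := hj y; have := hx' (alpha j); rlra.
have pE : p = g (alpha k) by have := hk l; have := hx' (alpha k); rlra.
have k1 := inc _ kn.
have [dk1 _] := cont _ kn.
have /departureP[k1_01 _] := dk1.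
have gt_k z : 0 <= z < alpha k -> g (alpha k) < g z.
  move=> zk; rewrite -ltrN2.
  apply: (@departure_gt0 _ (fun x => - g x)); rewrite ?g0 ?oppr0 //; last rlra.
    exact: continuousN.
  exact/departureN.
have lt_k1 z : 0 <= z < alpha k.+1 -> g z < g (alpha k.+1).
  exact: departure_gt0.
have hk1 z : 0 <= z <= alpha k.+1 -> g (alpha k) <= g z <= g (alpha k.+1).
  move=> zk; apply: hk; rewrite /leg_end; case: ifP => _ //.
  by move: zk => /andP[-> /le_trans ->] //; rlra.
have Ck : chain g p q.
  exists (alpha k); first rlra.
  rewrite pE qE; split; [|by exists (alpha k); rlra|by exists (alpha j); rlra].
  by move=> z /hj; rlra.
have [|lo [hi rj]] := @range_exists _ g 0 (alpha j) cg; first rlra.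
have [hrj [c cj gc] [d dj gd]] := rj.
have hiE : hi = q by have := hrj (alpha j); have := hj d; rlra.
split.
- by rewrite pE qE; apply: gt_k; rlra.
- exists p, lo; split => //; last by exists (alpha j); [rlra|rewrite -hiE].
  by rewrite pE -gc; apply: gt_k; rlra.
- exists q, (g (alpha k.+1)); split => //; first by rewrite qE; apply: lt_k1; rlra.
  exists (alpha k.+1); first rlra.
  rewrite pE; split => //; [by exists (alpha k); rlra|by exists (alpha k.+1); rlra].
Qed.

End Lifting.

Section LiftExistence.
Variable R : realType.
Implicit Types (f g h s t G : R -> R) (alpha tau v phi : nat -> R) (i j k n : nat).
Implicit Types (a b c d e lo hi p q u x y z m M w : R).

(** Along leg [k] the values of [g] stay between [v k] and [v k.+1], and [t] runs affinely through
    them on [[w k, w k.+1]]; [s] composes [g] with the inverse of that affine map. *)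
Lemma lift_exists g t : continuous g -> g 0 = 0 -> contour_factor g t ->
  exists s, lifting g t s.
Proof.
move=> cg g0 /contour_factor_seq[alpha [n [cs tval taff]]].
have [n0 a0 inc cont all] := cs.
have nR : 0 < n%:R :> R by rewrite ltr0n.
pose v i := g (alpha i); pose w i : R := i%:R / n%:R.
(* [c i] freezes [x] outside leg [i], so the ramp [phi i] is 0 before its leg, 1 after it and
   follows [g] on it. *)
pose c i x := Num.max (alpha i) (Num.min (leg_end alpha n i) x).
pose phi i x := clamp01 ((g (c i x) - v i) / (v i.+1 - v i)).
pose s x := ladder w (phi ^~ x) n.
have w1 i : w i.+1 - w i = n%:R^-1.
  by rewrite /w -mulrBl -natrB ?leqnSn // subSnn mul1r.
have ends i : (i < n)%N -> alpha i < leg_end alpha n i.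
  move=> ilt; rewrite /leg_end; case: ifP => [/eqP iN|_]; last exact: inc.
  by have /departureP[] := proj1 (cont _ ilt); have := inc _ ilt; rlra.
have ai0 i : (i <= n)%N -> 0 <= alpha i.
  by move=> ilt; rewrite -a0; apply: (contour_seq_leq cs).
have ratio i x : (i < n)%N -> 0 <= x <= leg_end alpha n i ->
    v i.+1 - v i != 0 /\ 0 <= (g x - v i) / (v i.+1 - v i) <= 1.
  move=> ilt xi; rewrite /v.
  have [[gi1 gi hi]|[gi1 gi hi]] := contour_seq_leg cg g0 cs ilt; have hx := hi x xi.
    have d : 0 < g (alpha i.+1) - g (alpha i) by rlra.
    by split; [rlra|rewrite ler_pdivlMr ?ler_pdivrMr//; rlra].
  have d : 0 < g (alpha i) - g (alpha i.+1) by rlra.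
  split; first rlra.
  rewrite -mulrNN -invrN !opprB ler_pdivlMr ?ler_pdivrMr//; rlra.
have cell x : 0 <= x <= 1 -> exists k, (k < n)%N /\ alpha k <= x <= leg_end alpha n k.
  move=> x01; have [|k [kn kx xk]] := @knots_cell _ alpha n x n0; first rlra.
  exists k; split => //; rewrite kx /leg_end; case: eqP => [_|/eqP kn']; first rlra.
  by apply/ltW/xk; rewrite ltn_neqAle kn'.
have sE k x : (k < n)%N -> alpha k <= x <= leg_end alpha n k ->
    s x = w k + (w k.+1 - w k) * ((g x - v k) / (v k.+1 - v k)).
  move=> kn xk; rewrite /s (@ladder_cell _ _ _ _ k) //.
  - have cx : c k x = x by rewrite /c minEle; case: ifP => ?; rewrite maxEle; case: ifP => ?; rlra.
    congr (_ + _ * _); rewrite /phi cx; apply: clamp01_id.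
    by have [] := ratio k x kn _; first by have := ai0 k (ltnW kn); rlra.
  - move=> i ik; have ilt := ltn_trans ik kn.
    have ei : leg_end alpha n i = alpha i.+1.
      by rewrite /leg_end ltn_eqF //; apply: leq_ltn_trans kn.
    have lt1 := inc i ilt.
    have le1 : alpha i.+1 <= alpha k by apply: (contour_seq_leq cs); rewrite ik ltnW.
    have cx : c i x = alpha i.+1.
      by rewrite /c ei minEle; case: ifP => ?; rewrite maxEle; case: ifP => ?; rlra.
    rewrite /phi cx; have [|d _] := ratio i (alpha i) ilt _.
      by have := ai0 i (ltnW ilt); have := ends i ilt; rlra.
    by rewrite divff // clamp01_ge1.
  - move=> i /andP[ki ilt].
    have ek : leg_end alpha n k = alpha k.+1.
      by rewrite /leg_end ltn_eqF //; apply: leq_ltn_trans ilt.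
    have le1 : alpha k.+1 <= alpha i by apply: (contour_seq_leq cs); rewrite ki ltnW.
    have := ends i ilt => lt2.
    have cx : c i x = alpha i.
      by rewrite /c minEle; rewrite ek in xk; case: ifP => ?; rewrite maxEle; case: ifP => ?; rlra.
    by rewrite /phi cx subrr mul0r clamp01_le0.
have w0 i : 0 <= w i by rewrite /w divr_ge0.
have wle i : (i <= n)%N -> w i <= 1.
  by move=> ilt; rewrite /w ler_pdivrMr // mul1r ler_nat.
have wn : 0 < n%:R^-1 :> R by rewrite invr_gt0.
have s_leg k x : (k < n)%N -> alpha k <= x <= leg_end alpha n k -> w k <= s x <= w k.+1.
  move=> kn xk; rewrite (sE k x kn xk).
  have [|_ r01] := ratio k x kn _; first by have := ai0 k (ltnW kn); rlra.
  by have := w1 k; nra.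
exists s; split.
- apply: continuous_ladder => i _; apply: continuous_clamp01 => x; apply: cvgM; last exact: cvg_cst.
  apply: cvgB; last exact: cvg_cst.
  apply: (@continuous_compU _ _ _ (c i) g) => //; apply: continuous_maxr; first by move=> ?; exact: cvg_cst.
  by apply: continuous_minr; [move=> ?; exact: cvg_cst|move=> ?; exact: cvg_id].
- by rewrite (sE 0%N) // ?a0 ?lexx ?(ltW (ends _ _)) //;
    [rewrite /v a0 subrr mul0r mulr0 /w mul0r addr0|have := ends _ n0; rewrite a0; rlra].
- move=> x x01; have [k [kn xk]] := cell x x01.
  have swk := s_leg k x kn xk; split.
    by have := w0 k; have := wle _ kn; rlra.
  have [mu [cst aff]] := taff k kn; have wk := wle _ kn.
  have d : 0 < w k.+1 - w k by rewrite w1.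
  have {}aff y : w k <= y <= w k.+1 -> t y = mu * y + cst.
    by move=> yk; apply: aff; rewrite in_itv.
  have e1 : t (w k) = mu * w k + cst by apply: aff; rlra.
  have e2 : t (w k.+1) = mu * w k.+1 + cst by apply: aff; rlra.
  rewrite aff //.
  have [|dk _] := ratio k x kn _; first by have := ai0 k (ltnW kn); rlra.
  rewrite (tval k (ltnW kn)) in e1; rewrite (tval _ kn) in e2.
  rewrite (sE k x kn xk) mulrDr addrAC -e1.
  have -> : mu * ((w k.+1 - w k) * ((g x - v k) / (v k.+1 - v k))) =
      (mu * w k.+1 + cst - (mu * w k + cst)) * ((g x - v k) / (v k.+1 - v k)) by ring.
  by rewrite -e2 -e1 mulrC divfK // /v; ring.
- have nE : n.-1.+1 = n by apply: prednK.
  have n1 : (n.-1 < n)%N by rewrite nE.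
  have lt1 := inc _ n1; rewrite nE in lt1.
  have e1 : leg_end alpha n n.-1 = 1 by rewrite /leg_end nE eqxx.
  have /departureP[an _] := proj1 (cont _ n1); rewrite nE in an.
  exists (alpha n); first rlra.
  rewrite (sE n.-1) //; last by rewrite e1; rlra.
  have [|d _] := ratio n.-1 (alpha n) n1 _; first by rewrite e1; rlra.
  rewrite nE /v in d *; rewrite divff // mulr1 addrCA subrr addr0 /w divff //.
  by rewrite pnatr_eq0 -lt0n.
(* If [x] came before leg [k], the departure [alpha k] would bring a new value between [x] and [x'].
   So both lie on one leg, where [s] is an increasing function of [g] or of [- g]. *)
- move=> x x' p q xx' x'1 rx rx' lts; have [|k [kn xk]] := cell x'; first rlra.
  case: (le_or_lt (alpha k) x) => [kx|xk']; last first.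
    have [j kj] : exists j, k = j.+1.
      by case: (k) xk' => [|j]; [rewrite a0; rlra|exists j].
    have jn : (j < n)%N by apply: leq_trans kn; rewrite kj.
    have /departureP[k01 hk] := proj1 (cont _ jn); rewrite -kj in k01 hk.
    have [hx' _ _] := rx'.
    have [|z z0 gz] := range_onto (v := g (alpha k)) cg rx; first by apply: hx'; rlra.
    by case: (hk z) => //; rlra.
  have ratio_lt y : alpha k <= y <= x ->
      (g y - v k) / (v k.+1 - v k) < (g x' - v k) / (v k.+1 - v k).
    move=> yk; have := lts y; rewrite (sE k y kn) ?(sE k x' kn) //; last by rlra.
    by rewrite ltrD2l ltr_pM2l ?w1 //; apply; have := ai0 k (ltnW kn); rlra.
  have [lg|lg] := contour_seq_leg cg g0 cs kn.
    apply: (leg_stall cg g0 cs kn lg (x := x) (x' := x')) => //; [rlra|rlra|].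
    move=> y /ratio_lt; have [gk1 gk _] := lg.
    by rewrite ltr_pM2r ?ltrD2r // invr_gt0 /v; rlra.
  have n0' : - g 0 = 0 by rewrite g0 oppr0.
  have [|||pq ph pl] := leg_stall (continuousN cg) n0' (contour_seqN cs) kn lg
    (x := x) (x' := x') (p := - q) (q := - p) _ _ (rangeN rx) (rangeN rx') _.
  - rlra.
  - rlra.
  - move=> y /ratio_lt; have [gk1 gk _] := lg.
    rewrite -mulrNN -invrN -[ltRHS]mulrNN -invrN ltr_pM2r ?invr_gt0 /v; last rlra.
    by rlra.
  - split; first rlra.
      by have := plateau_loN pl; rewrite opprK.
    by have := plateau_hiN ph; rewrite opprK.
Qed.

(** [contour_factor] prescribes [t] on [[0, 1]] only; the interpolation through its vertices is
    continuous on the whole line. *)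
Lemma contour_factor_interp g t : contour_factor g t ->
  exists T, continuous T /\ forall x, 0 <= x <= 1 -> T x = t x.
Proof.
move=> /contour_factor_seq[alpha [n [[n0 _ _ _ _] _ taff]]].
pose w i : R := i%:R / n%:R; have nR : 0 < n%:R :> R by rewrite ltr0n.
have inc : knots w n by move=> i _; rewrite ltr_pM2r ?invr_gt0 // ltr_nat.
exists (interp w (fun i => t (w i)) n); split; first exact: continuous_interp.
move=> x x01; have [|k [kn kx xk]] := knots_cell n0 (_ : w 0%N <= x).
  by rewrite /w mul0r; rlra.
have xk1 : w k <= x <= w k.+1.
  rewrite kx; have [/xk/ltW //|] := boolP (k.+1 < n)%N.
  rewrite -leqNgt => nk; have -> : k.+1 = n by apply/eqP; rewrite eqn_leq kn nk.
  by rewrite /w divff ?pnatr_eq0 -?lt0n //; rlra.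
rewrite (interp_cell _ inc kn xk1); have [mu [c aff]] := taff k kn.
have d := inc k kn.
have {}aff y : w k <= y <= w k.+1 -> t y = mu * y + c.
  by move=> yk; apply: aff; rewrite in_itv.
rewrite !aff //; try rlra.
have dn : w k.+1 - w k != 0 by rlra.
by field.
Qed.

End LiftExistence.

(** * Contour twins, plateaus and lifts on both arms *)

Section RadialLift.
Variable R : realType.
Implicit Types (f g h k s t T sigma : R -> R) (a b p q r u v x y z : R).

(** [a] and [b] are the first times at which [r] and [p] are reached. As [a <= y2 < b], an opposite
    extremum follows [a], which also keeps [a] below 1. *)
Lemma plateau_contour g r : continuous g -> g 0 = 0 -> 0 < r ->
  plateau_hi (chain g) r -> exists a, [/\ contour_point g a, 0 < a < 1 & g a = r].
Proof.
move=> cg g0 r0 [p [q [pq [y1 y1_01 ry1] [y2 y2_01 ry2]]]].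
have [h1 [c c01 gc] _] := ry1; have [h2 _ [d d01 gd]] := ry2.
have y21 : y2 < c by rewrite ltNge; apply/negP => cy2; have := h2 c; rlra.
have [||a [a01 ga lta]] := @first_hit _ g d r cg; [rlra|by rewrite g0 gd; rlra|].
have q0 : q <= 0 by have := h2 0; rewrite g0; rlra.
have [||b [b01 gb ltb]] := @first_hit _ (fun x => - g x) c (- p) (continuousN cg).
- rlra.
- by rewrite g0 gc; rlra.
have a0 : 0 < a.
  rewrite lt_neqAle; apply/andP; split; last rlra.
  by apply/eqP => a0; move: ga; rewrite -a0 g0; rlra.
have yb : y2 < b by rewrite ltNge; apply/negP => by2; have := h2 b; rlra.
exists a; split => //; last rlra.
apply: (extremum_contour (b := b) cg g0); [rlra|rlra| | |rlra|].
- by move=> y /lta; rewrite ga.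
- by move=> y yb'; have := h1 y; rlra.
- by move=> y /ltb; rlra.
Qed.

(** An arm whose range pauses at the upper end 0 starts out at or below 0. *)
Lemma plateaus_local_max f : f 0 = 0 -> plateau_hi (chain f) 0 ->
  plateau_hi (chain (f \o -%R)) 0 -> local_max f 0.
Proof.
have below g : plateau_hi (chain g) 0 -> g 0 = 0 ->
    exists2 y, 0 < y & forall x, 0 <= x <= y -> g x <= 0.
  move=> [p [q [pq [y y01 [hy [a a0 ga] _]] [z z01 [hz _ _]]]]] g0.
  exists y => [|x /hy]; last rlra.
  rewrite lt_neqAle; apply/andP; split; last rlra.
  apply/eqP => y0; have a00 : a = 0 by rlra.
  by move: ga; rewrite a00 g0 => p0; have := hz 0; rewrite g0; rlra.
move=> f0 hr hl; have [y y0 hy] := below f hr f0.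
have [|z z0 hz] := below (f \o -%R) hl; first by rewrite /= oppr0.
apply/nbhs_ballP; exists (Num.min y z) => /=; first by rewrite lt_min y0 z0.
move=> x; rewrite /ball /= sub0r normrN lt_min !ltr_norml f0 => xyz.
case: (le_or_lt 0 x) => x0; first by apply: hy; rlra.
by have /= := hz (- x); rewrite opprK; apply; rlra.
Qed.

Lemma no_contour_twinsN f : no_contour_twins f -> no_contour_twins (fun x => - f x).
Proof.
move=> [[nmin nmax] tw]; split.
  split=> [fmin|fmax]; [apply: nmax|apply: nmin].
    by apply: filterS fmin => y /=; rewrite lerN2.
  by apply: filterS fmax => y /=; rewrite lerN2.
move=> a b /contour_pointN ca [b0 /contour_pointN cb] a01 b01 /oppr_inj.
by apply: tw.
Qed.

Lemma chainNN f p q : chain f p q -> chain (fun x => - f x) (- q) (- p).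
Proof. by move=> c; apply/chainN; rewrite !opprK. Qed.

(** A common upper plateau [r > 0] gives twins by [plateau_contour], and [r = 0] a local maximum;
    [r < 0] is impossible since [f 0 = 0]. Lower ends follow by negation. *)
Lemma no_contour_twins_twinless f : continuous f -> f 0 = 0 ->
  no_contour_twins f -> twinless f.
Proof.
have hi g r : continuous g -> g 0 = 0 -> no_contour_twins g ->
    plateau_hi (chain g) r -> plateau_hi (chain (g \o -%R)) r -> False.
  move=> cg g0 [[_ nmax] tw] hr hl.
  have r0 : 0 <= r.
    have [_ [q [_ _ [y y01 [hy _ _]]]]] := hr.
    by have := hy 0; rewrite g0; rlra.
  case: (le_or_lt r 0) => r0'.
    have r00 : r = 0 by rlra.
    by apply: nmax; apply: plateaus_local_max => //; rewrite -r00.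
  have [a [ca a01 ga]] := plateau_contour cg g0 r0' hr.
  have [|b [cb b01 gb]] := plateau_contour (continuous_refl cg) _ r0' hl.
    by rewrite oppr0.
  apply: (tw a (- b)) => //; last by rewrite ga -gb.
  - by split; [rlra|rewrite opprK].
  - rlra.
move=> cf f0 tw r; split=> -[hr hl]; first exact: (hi f r).
apply: (hi (fun x => - f x) (- r)).
- exact: continuousN.
- by rewrite f0 oppr0.
- exact: no_contour_twinsN.
- have [p [q [pq h1 h2]]] := hr; exists (- q), (- p).
  by split; [rlra|exact: chainNN|exact: chainNN].
- have [p [q [pq h1 h2]]] := hl; exists (- q), (- p).
  by split; [rlra|exact: (@chainNN (f \o -%R))|exact: (@chainNN (f \o -%R))].
Qed.

(** A lift [s] fills [[0, u]] up to time [x], so [g] takes on [[0, x]] exactly the values of [t] on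
    [[0, u]]. *)
Definition sweeps g t s x u :=
  [/\ 0 <= x <= 1, s x = u & forall y, 0 <= y <= x -> 0 <= s y <= u /\ g y = t (s y)].

Lemma lift_sweeps g t s u : lifting g t s -> 0 <= u <= 1 -> exists x, sweeps g t s x u.
Proof.
move=> [cs s0 s01 [z z01 sz] _] u01.
have [||x [x01 sx ltx]] := @first_hit _ s z u cs; [rlra|by rewrite s0 sz|].
exists x; split => //; first rlra.
move=> y yx; have [|s1 ->] := s01 y; first rlra.
split => //; have [->|yx'] := eqVneq y x; first rlra.
have yx2 : y < x by rewrite lt_neqAle yx'; rlra.
by have := ltx y; rlra.
Qed.

(** Every initial range of [g'] is the image of some [[0, u]] under the common [t], with [u] the
    maximum of [s']; [g] has swept the same image when [s] first reaches [u]. *)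
Lemma lift_chain g g' t s s' p q : lifting g t s -> lifting g' t s' ->
  chain g' p q -> chain g p q.
Proof.
move=> lg [cs' s'0 s'01 _ _] [y y01 [hy [a a0 ga] [b b0 gb]]].
have [|lo [u ru]] := @range_exists _ s' 0 y cs'; first rlra.
have [hru _ [c c0 sc]] := ru.
have u01 : 0 <= u <= 1 by have := s'01 c; rewrite sc; rlra.
have [cs s0 s01 _ _] := lg.
have [x [x01 sx hx]] := lift_sweeps lg u01.
have lo0 : lo <= 0 by have := hru 0; rewrite s'0; rlra.
have rt v : 0 <= v <= u -> exists2 z, 0 <= z <= y & s' z = v /\ t v = g' z.
  move=> vu; have [|z z0 sz] := range_onto (v := v) cs' ru; first rlra.
  by exists z => //; split => //; rewrite -sz; apply: (proj2 (s'01 z _)); rlra.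
have hit c' : 0 <= c' <= y -> exists2 z, 0 <= z <= x & g z = g' c'.
  move=> c'y; have c'1 : 0 <= c' <= 1 by rlra.
  have [s1 s2] := s'01 c' c'1.
  have := hru c' c'y => s3.
  have [||z z0 sz] := @ivt_between _ s 0 x (s' c') cs; [rlra|by left; rewrite s0 sx; rlra|].
  by exists z => //; rewrite (proj2 (hx z z0)) sz s2.
exists x => //; split.
- move=> z zx; have [s1 ->] := hx z zx; have [w wy [_ ->]] := rt _ s1; exact: hy.
- by have [z zx gz] := hit a a0; exists z => //; rewrite gz.
- by have [z zx gz] := hit b b0; exists z => //; rewrite gz.
Qed.

Definition pos x : R := Num.max 0 x.

Lemma pos_ge0 x : 0 <= x -> pos x = x.
Proof. by move=> x0; apply/max_idPr. Qed.

Lemma pos_le0 x : x <= 0 -> pos x = 0.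
Proof. by move=> x0; apply/max_idPl. Qed.

Lemma continuous_pos (U : topologicalType) (F : U -> R) :
  continuous F -> continuous (fun z : U => pos (F z)).
Proof. by move=> cF; apply: continuous_maxr => // ?; exact: cvg_cst. Qed.

(** For arms that vanish at 0 one summand is always 0; the sum makes continuity at the origin
    automatic. *)
Definition glue (fr fl : R -> R) x := fr (pos x) + fl (pos (- x)).

Lemma glue_ge0 fr fl x : fl 0 = 0 -> 0 <= x -> glue fr fl x = fr x.
Proof. by move=> l0 x0; rewrite /glue (pos_ge0 x0) pos_le0 ?oppr_le0 // l0 addr0. Qed.

Lemma glue_le0 fr fl x : fr 0 = 0 -> 0 <= x -> glue fr fl (- x) = fl x.
Proof. by move=> r0 x0; rewrite /glue opprK (pos_ge0 x0) pos_le0 ?oppr_le0 // r0 add0r. Qed.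

Lemma continuous_glue fr fl : continuous fr -> continuous fl -> continuous (glue fr fl).
Proof.
move=> cr cl x; have cN : continuous (fun y : R => pos (- y)).
  by apply: continuous_pos; exact: opp_continuous.
apply: cvgD; last exact: (continuous_compU cN cl).
by apply: (fun cp => continuous_compU cp cr); apply: continuous_pos => ?; exact: cvg_id.
Qed.

(* T is a two-armed contour factor of f and sigma a lift of f \o h through it. *)
Definition radial_lift f h T sigma :=
  [/\ [/\ continuous T, continuous sigma, T 0 = 0, sigma 0 = 0 & unit_map sigma],
      forall x, - 1 <= x <= 1 -> T (sigma x) = f (h x),
      exists sr sl,
        (forall u, 0 <= u <= 1 -> exists x, sweeps f T sr x u) /\
        (forall u, 0 <= u <= 1 -> exists x, sweeps (f \o -%R) (T \o -%R) sl x u),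
      subordinate f h
    & forall k x1 x2, continuous k -> k 0 = 0 -> unit_map k ->
        twinless f -> twinless h -> subordinate h k ->
        0 <= x1 <= 1 -> 0 <= x2 <= 1 -> ~ negative_departure (sigma \o k) x1 x2].

(** All four lifts go through the one [t]: those of the arms of [f] make up [s], comparing them with
    those of [f \o h] gives [subordinate], and [sl'], with its turns at plateaus, is the left arm of
    [sigma] up to sign. *)
Lemma radial_lift_exists f h t : continuous f -> continuous h -> f 0 = 0 -> h 0 = 0 ->
  unit_map h -> radial_contour_factor f t -> radial_contour_factor (f \o h) t ->
  exists T sigma, radial_lift f h T sigma.
Proof.
move=> cf ch f0 h0 uh [cfr cfl] [cfhr cfhl].
have cfh : continuous (f \o h) by exact: continuous_compU.
have cf' := continuous_refl cf; have cfh' := continuous_refl cfh.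
have f0' : (f \o -%R) 0 = 0 by rewrite /= oppr0.
have fh0 : (f \o h) 0 = 0 by rewrite /= h0.
have fh0' : (f \o h \o -%R) 0 = 0 by rewrite /= oppr0 h0.
have [Tr [cTr Trt]] := contour_factor_interp cfr.
have [Tl [cTl Tlt]] := contour_factor_interp cfl.
have [sr lr] := lift_exists cf f0 cfr.
have [sl ll] := lift_exists cf' f0' cfl.
have [sr' lr'] := lift_exists cfh fh0 cfhr.
have [sl' ll'] := lift_exists cfh' fh0' cfhl.
have [csr sr0 sr01 _ _] := lr; have [csl sl0 sl01 _ _] := ll.
have [csl' sl'0 sl'01 _ turns] := ll'.
have t0 : t 0 = 0.
  by have [|_] := sr01 0 _; [rlra|rewrite sr0 f0].
have Tr0 : Tr 0 = 0 by rewrite Trt ?t0 //; rlra.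
have Tl0 : Tl 0 = 0 by rewrite Tlt /= ?oppr0 ?t0 //; rlra.
pose T := glue Tr Tl.
have TE x : 0 <= x <= 1 -> T x = t x.
  by move=> x01; rewrite /T glue_ge0 ?Trt //; rlra.
have TNE x : 0 <= x <= 1 -> T (- x) = t (- x).
  by move=> x01; rewrite /T glue_le0 ?Tlt //; rlra.
pose s := glue sr (fun x => - sl x).
have nsl0 : - sl 0 = 0 by rewrite sl0 oppr0.
have cs : continuous s by apply: continuous_glue => //; exact: continuousN.
have s0 : s 0 = 0 by rewrite /s glue_ge0 ?sr0.
have sE x : 0 <= x -> s x = sr x by move=> x0; rewrite /s glue_ge0.
have sNE x : 0 <= x -> s (- x) = - sl x by move=> x0; rewrite /s glue_le0.
have us : unit_map s.
  move=> x x1; case: (le_or_lt 0 x) => x0; first by rewrite sE //; have := sr01 x; rlra.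
  by rewrite -[x]opprK sNE; [have := sl01 (- x); rlra|rlra].
have Ts x : - 1 <= x <= 1 -> T (s x) = f x.
  move=> x1; case: (le_or_lt 0 x) => x0.
    have [|s1 s2] := sr01 x; first rlra.
    by rewrite sE // TE.
  have [|s1 s2] := sl01 (- x); first rlra.
  by rewrite -[x]opprK sNE; [rewrite TNE|rlra].
pose sigma := glue (s \o h) (fun x => - sl' x).
have nsl'0 : - sl' 0 = 0 by rewrite sl'0 oppr0.
have sh0 : (s \o h) 0 = 0 by rewrite /= h0.
have sigE x : 0 <= x -> sigma x = s (h x) by move=> x0; rewrite /sigma glue_ge0.
have sigNE x : 0 <= x -> sigma (- x) = - sl' x by move=> x0; rewrite /sigma glue_le0.
have sub : subordinate f h.
  by split=> lo hi; [exact: (lift_chain lr lr')|exact: (lift_chain ll ll')].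
exists T, sigma; split => //.
- split.
  + exact: continuous_glue.
  + by apply: continuous_glue; [exact: continuous_compU|exact: continuousN].
  + by rewrite /T glue_ge0.
  + by rewrite sigE ?h0.
  + move=> x x1; case: (le_or_lt 0 x) => x0; first by rewrite sigE //; exact/us/uh.
    by rewrite -[x]opprK sigNE; [have := sl'01 (- x); rlra|rlra].
- move=> x x1; case: (le_or_lt 0 x) => x0; first by rewrite sigE // Ts //; exact: uh.
  have [|s1 s2] := sl'01 (- x); first rlra.
  by rewrite -[x]opprK sigNE; [rewrite TNE|rlra].
- exists sr, sl; split=> u u01.
    have [x [x01 sx hx]] := lift_sweeps lr u01; exists x; split => // y yx.
    by have [s1 ->] := hx y yx; rewrite TE //; rlra.
  have [x [x01 sx hx]] := lift_sweeps ll u01; exists x; split => // y yx.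
  have [s1 /= s2] := hx y yx; split => //.
  by rewrite /= s2 TNE //; rlra.
- move=> k x1 x2 ck k0 uk ntf nth subk x10 x20.
  apply: (no_negative_departure cf ch ck f0 h0 k0 uh uk ntf nth sub subk s0 _ _ turns) => //.
  + move=> x x1'; rewrite -[x]opprK sNE; last rlra.
    by have := sl01 (- x); rlra.
  + by move=> x x01; have := sl'01 x; rlra.
  + by move=> x x01; apply: sigE; rlra.
  + by move=> x x01; apply: sigNE; rlra.
Qed.

(* As k sweeps T', a departure of sigma \o T' comes from one of sigma \o k. *)
Lemma radial_lift_departure f h T sigma k l T' sigma' x1 x2 :
  radial_lift f h T sigma -> radial_lift k l T' sigma' ->
  continuous k -> k 0 = 0 -> unit_map k -> twinless f -> twinless h -> subordinate h k ->
  0 <= x1 <= 1 -> 0 <= x2 <= 1 -> ~ negative_departure (sigma \o T') x1 x2.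
Proof.
move=> [_ _ _ _ dep] [_ _ [sr [sl [hr hl]]] _ _] ck k0 uk ntf nth subk x10 x20 [/= d1 d2].
have [u2 [u20 su2 hu2]] := hr x2 x20; have [u1 [u10 su1 hu1]] := hl x1 x10.
have e1 : k (- u1) = T' (- x1) by have [|_ /= ->] := hu1 u1 _; [rlra|rewrite su1].
have e2 : k u2 = T' x2 by have [|_ ->] := hu2 u2 _; [rlra|rewrite su2].
apply: (dep k u1 u2) => //; split=> y yu /=.
  by rewrite e1; have [s1 ->] := hu2 y yu; exact: d1.
by rewrite e2; have [s1 /= ->] := hu1 y yu; exact: d2.
Qed.

End RadialLift.

(** * The planar approximation step *)

Section LatticePath.
Variable R : realType.
Implicit Types (L U : nat -> R) (i j k m n : nat).

Inductive reach L U : nat -> nat -> Prop :=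
| reach_start : L 0%N <= U 0%N -> reach L U 0 0
| reach_left i j : reach L U i j -> L i.+1 <= U j -> reach L U i.+1 j
| reach_right i j : reach L U i j -> L i <= U j.+1 -> reach L U i j.+1.

Lemma reach_right_iter L U i j n : reach L U i j -> (j <= n)%N ->
  (forall k, (k <= n)%N -> L i <= U k) -> reach L U i n.
Proof.
move=> rij; elim: n => [|n IH] jn h.
  by move: jn rij; rewrite leqn0 => /eqP ->.
move: jn; rewrite leq_eqVlt => /orP[/eqP <- //|jn].
by apply: reach_right; [apply: IH => // k kn; apply: h; exact: leqW|exact: h].
Qed.

Lemma reach_left_iter L U i j m : reach L U i j -> (i <= m)%N ->
  (forall k, (k <= m)%N -> L k <= U j) -> reach L U m j.
Proof.
move=> rij; elim: m => [|m IH] im h.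
  by move: im rij; rewrite leqn0 => /eqP ->.
move: im; rewrite leq_eqVlt => /orP[/eqP <- //|im].
by apply: reach_left; [apply: IH => // k km; apply: h; exact: leqW|exact: h].
Qed.

Lemma ex_argmax L n : exists2 i, (i <= n)%N & forall k, (k <= n)%N -> L k <= L i.
Proof.
elim: n => [|n [i ilt hi]]; first by exists 0%N => // k; rewrite leqn0 => /eqP ->.
case: (le_or_lt (L n.+1) (L i)) => h.
  exists i => [|k]; first exact: leqW.
  by rewrite leq_eqVlt => /orP[/eqP -> //|]; exact: hi.
exists n.+1 => // k; rewrite leq_eqVlt => /orP[/eqP -> //|kn].
by apply: le_trans (ltW h); exact: hi.
Qed.

Lemma ex_argmin L n : exists2 i, (i <= n)%N & forall k, (k <= n)%N -> L i <= L k.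
Proof.
have [i ilt hi] := ex_argmax (fun k => - L k) n.
by exists i => // k /hi; rewrite lerN2.
Qed.

Definition lattice_departure L U i j :=
  (forall k, (k <= j)%N -> U k < L i) /\ (forall k, (k <= i)%N -> U j < L k).

(* A discrete mountain-climbing lemma: induction on m + n, cutting back to the
   last record of U or of L that already dominates the whole rectangle. *)
Lemma lattice_path L U m n :
  (forall i, (i <= m)%N -> L m <= L i) -> (forall j, (j <= n)%N -> L m <= U j) ->
  (forall i, (i <= m)%N -> L i <= U n) -> (forall j, (j <= n)%N -> U j <= U n) ->
  (forall i j, (i <= m)%N -> (j <= n)%N -> ~ lattice_departure L U i j) ->
  reach L U m n.
Proof.
have [s] := ubnP (m + n); elim: s m n => // s IH m n smn LL LU UL UU nd.
have L0U0 : L 0%N <= U 0%N.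
  rewrite leNgt; apply/negP => UL0; apply: (nd 0%N 0%N) => //.
  by split=> k; rewrite leqn0 => /eqP ->.
have start := reach_start L0U0.
case: m => [|m] in smn LL LU UL nd *; first exact: reach_right_iter start _ LU.
case: n => [|n] in smn LU UL UU nd *; first exact: reach_left_iter start _ UL.
have [j jn hj] := ex_argmax U n; have [i im hi] := ex_argmin L m.
(* If [U j] dominates every [L], induction reaches [(m.+1, j)], and from there the path moves right
   because [L m.+1] is minimal. *)
have [h|] := boolP [forall k : 'I_m.+2, L k <= U j].
  have LUj k : (k <= m.+1)%N -> L k <= U j.
    by rewrite -ltnS => km; exact: (forallP h (Ordinal km)).
  apply: (reach_right_iter _ (leqW jn) LU); apply: IH => //.
  - by rewrite addnS ltnS in smn; apply: leq_ltn_trans smn; rewrite leq_add2l.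
  - by move=> k kj; apply: LU; apply: leq_trans kj (leqW jn).
  - by move=> k kj; apply: hj; exact: leq_trans kj jn.
  - by move=> i' j' i'm j'j; apply: nd => //; apply: leq_trans j'j (leqW jn).
move=> /forallPn[[a am] /=]; rewrite -ltNge => Uja.
have [h|] := boolP [forall k : 'I_n.+2, L i <= U k].
  have LiU k : (k <= n.+1)%N -> L i <= U k.
    by rewrite -ltnS => kn; exact: (forallP h (Ordinal kn)).
  apply: (reach_left_iter _ (leqW im) UL); apply: IH => //.
  - by rewrite addSn ltnS in smn; apply: leq_ltn_trans smn; rewrite leq_add2r.
  - by move=> k ki; apply: hi; exact: leq_trans ki im.
  - by move=> k ki; apply: UL; apply: leq_trans ki (leqW im).
  - by move=> i' j' i'i j'n; apply: nd => //; apply: leq_trans i'i (leqW im).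
move=> /forallPn[[b bn] /=]; rewrite -ltNge => Ubi.
have a_lt : (a < m.+1)%N.
  rewrite ltn_neqAle -ltnS am andbT; apply/eqP => aE.
  by move: (LU j (leqW jn)); rewrite -aE leNgt Uja.
have b_lt : (b < n.+1)%N.
  rewrite ltn_neqAle -ltnS bn andbT; apply/eqP => bE.
  by move: (UL i (leqW im)); rewrite -bE leNgt Ubi.
(* Now [L a] exceeds every [U] up to [n] and [U b] is below every [L] up to [m]: a lattice
   departure. *)
case: (nd a b) => //; split=> k.
  by move=> kb; apply: le_lt_trans Uja; apply: hj; apply: leq_trans kb _.
by move=> ka; apply: lt_le_trans Ubi _; apply: hi; apply: leq_trans ka _.
Qed.

Definition lattice_step (I J : nat -> nat) k :=
  I k.+1 = (I k).+1 /\ J k.+1 = J k \/ I k.+1 = I k /\ J k.+1 = (J k).+1.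

Lemma reach_sequence L U m n : reach L U m n ->
  exists K I J, [/\ I 0%N = 0%N /\ J 0%N = 0%N, I K = m /\ J K = n,
    forall k, (k < K)%N -> lattice_step I J k &
    forall k, (k <= K)%N -> L (I k) <= U (J k)].
Proof.
elim=> [h|i j _ [K [I [J [[I0 J0] [IK JK] st le]]]] h|i j _ [K [I [J [[I0 J0] [IK JK] st le]]]] h].
- by exists 0%N, (fun=> 0%N), (fun=> 0%N); split => // k; rewrite leqn0 => /eqP.
- exists K.+1, (fun k => if (k <= K)%N then I k else i.+1), (fun k => if (k <= K)%N then J k else j).
  rewrite /lattice_step /= !ltnn; split => // k.
    rewrite ltnS => kK; rewrite kK; move: kK; rewrite leq_eqVlt => /orP[/eqP ->|kK].
      by rewrite ltnn IK JK; left.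
    by rewrite kK; exact: st.
  by rewrite leq_eqVlt => /orP[/eqP ->|]; [rewrite ltnn|rewrite ltnS => kK; rewrite kK; exact: le].
- exists K.+1, (fun k => if (k <= K)%N then I k else i), (fun k => if (k <= K)%N then J k else j.+1).
  rewrite /lattice_step /= !ltnn; split => // k.
    rewrite ltnS => kK; rewrite kK; move: kK; rewrite leq_eqVlt => /orP[/eqP ->|kK].
      by rewrite ltnn IK JK; right.
    by rewrite kK; exact: st.
  by rewrite leq_eqVlt => /orP[/eqP ->|]; [rewrite ltnn|rewrite ltnS => kK; rewrite kK; exact: le].
Qed.

End LatticePath.

(** * Moduli of continuity by compactness *)

Section CompactModulus.
Variable R : realType.

(* Minimise phi + max(0, b - psi), which is positive on A. *)
Lemma compact_modulus (T : topologicalType) (A : set T) (phi psi : T -> R) (b : R) :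
  compact A -> continuous phi -> continuous psi -> (forall z, A z -> 0 <= phi z) ->
  (forall z, A z -> phi z = 0 -> psi z = 0) -> 0 < b ->
  exists2 e, 0 < e & forall z, A z -> phi z < e -> psi z < b.
Proof.
move=> cA cphi cpsi phi0 psi0 b0.
have [->|A0] := eqVneq A set0; first by exists 1.
pose F z := phi z + Num.max 0 (b - psi z).
have cF : continuous F.
  have c2 : continuous (fun z => b - psi z).
    by move=> z; apply: cvgB; [exact: cvg_cst|exact: cpsi].
  have c0 : continuous (fun _ : T => 0 : R) by move=> z; exact: cvg_cst.
  by move=> z; apply: cvgD; [exact: cphi|exact: (continuous_maxr c0 c2)].
have [|c Ac hc] := @compact_EVT_min T R F A _ cA (continuous_subspaceT cF).
  exact/set0P.
have FE z : F z = phi z /\ b <= psi z \/ F z = phi z + (b - psi z) /\ psi z < b.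
  rewrite /F maxEle; case: (le_or_lt b (psi z)) => h; [left|right].
    by split => //; case: ifP => h'; rlra.
  by split => //; case: ifP => h'; rlra.
rewrite inE in Ac; exists (F c).
  have pc := phi0 c Ac; case: (FE c) => -[-> h]; last rlra.
  rewrite lt_neqAle pc andbT eq_sym; apply/eqP => pc0.
  by have := psi0 c Ac pc0; rlra.
move=> z Az; have := hc z; rewrite inE => /(_ Az) hz pz.
by case: (FE z) => -[h h']; rlra.
Qed.

Lemma uniform_modulus (G : R -> R) a b e : continuous G -> 0 < e ->
  exists2 d, 0 < d & forall x y, a <= x <= b -> a <= y <= b ->
    `|x - y| < d -> `|G x - G y| < e.
Proof.
move=> cG e0; pose A := `[a, b]%classic `*` `[a, b]%classic.
have [||||||d d0 hd] := @compact_modulus (R * R)%type A (fun z => `|z.1 - z.2|)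
    (fun z => `|G z.1 - G z.2|) e.
- by apply: compact_setX; exact: segment_compact.
- by move=> z; apply: cvg_norm; apply: cvgB; [exact: cvg_fst|exact: cvg_snd].
- move=> z; apply: cvg_norm; apply: cvgB.
    by apply: (continuous_comp (g := G)); [exact: cvg_fst|exact: cG].
  by apply: (continuous_comp (g := G)); [exact: cvg_snd|exact: cG].
- by move=> z _.
- by move=> z _ /eqP; rewrite normr_eq0 subr_eq0 => /eqP ->; rewrite subrr normr0.
- by [].
exists d => // x y xab yab; apply: (hd (x, y)).
by split => /=; rewrite in_itv.
Qed.

End CompactModulus.

(** * Parametrised arms and the bent line *)

Section PlanarArms.
Variable R : realType.
Implicit Types (F G : R -> R) (I J : nat -> nat) (i j k n N K : nat).
Implicit Types (a b c d e p q r u v x y : R) (z : R * R).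

Lemma clamp_between p q x : p <= q -> p <= Num.max p (Num.min q x) <= q.
Proof.
by move=> pq; rewrite minEle; case: ifP => ?; rewrite maxEle; case: ifP => ?; lra.
Qed.

Lemma clamp_lo p q x : p <= q -> x <= p -> Num.max p (Num.min q x) = p.
Proof. by move=> pq xp; rewrite (min_idPr (le_trans xp pq)) (max_idPl xp). Qed.

Lemma clamp_hi p q x : p <= q -> q <= x -> Num.max p (Num.min q x) = q.
Proof. by move=> pq qx; rewrite (min_idPl qx) (max_idPr pq). Qed.

(** Clamping is only weakly monotone; the added slope [c] makes the sum strictly increasing. *)
Lemma clamp_inj p q c x y : 0 < c ->
  Num.max p (Num.min q x) + c * x = Num.max p (Num.min q y) + c * y -> x = y.
Proof.
have lt u v : 0 < c -> u < v ->
    Num.max p (Num.min q u) + c * u < Num.max p (Num.min q v) + c * v.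
  move=> c0 uv; apply: ler_ltD; last by rewrite ltr_pM2l.
  by rewrite ge_max !le_max lexx /= le_min !ge_min lexx /= (ltW uv) !orbT.
move=> c0 xy; apply/eqP; rewrite eq_le !leNgt.
by apply/andP; split; apply/negP => /(lt _ _ c0); rewrite xy ltxx.
Qed.

Lemma scaled_bounds c p e u v : 0 < c -> c * p = e / 4 -> 0 <= u <= 2 * p ->
  - p <= v <= p -> 0 <= c * u <= e / 2 /\ - (e / 4) <= c * v <= e / 4.
Proof.
move=> c0 ce /andP[u0 up] /andP[pv vp].
have h1 := mulr_ge0 (ltW c0) u0.
have h2 : c * u <= c * (2 * p) by rewrite ler_pM2l.
have h3 : c * v <= c * p by rewrite ler_pM2l.
have h4 : c * - p <= c * v by rewrite ler_pM2l.
by split; lra.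
Qed.

Lemma continuous_pairing (U : topologicalType) (f g : U -> R) :
  continuous f -> continuous g -> continuous (fun u : U => (f u, g u)).
Proof.
by move=> cf cg u; apply: (cvg_pair (G := nbhs (f u)) (H := nbhs (g u)));
  [exact: cf|exact: cg].
Qed.

Lemma convex_norm_lt a b x lam e : `|a - x| < e -> `|b - x| < e -> 0 <= lam <= 1 ->
  `|a + (b - a) * lam - x| < e.
Proof.
move=> ha hb /andP[lam0 lam1].
have -> : a + (b - a) * lam - x = (1 - lam) * (a - x) + lam * (b - x) by ring.
apply: le_lt_trans (ler_normD _ _) _; rewrite !normrM (ger0_norm lam0) ger0_norm ?subr_ge0 //.
have [->|lam_gt0] := eqVneq lam 0; first by rewrite subr0 mul1r mul0r addr0.
have -> : e = (1 - lam) * e + lam * e by ring.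
apply: ler_ltD; first by rewrite ler_wpM2l ?subr_ge0 // ltW.
by rewrite ltr_pM2l // lt_neqAle eq_sym lam_gt0.
Qed.

Lemma convex_le a b p q lam : a <= p -> b <= q -> 0 <= lam <= 1 ->
  a + (b - a) * lam <= p + (q - p) * lam.
Proof.
move=> ap bq /andP[lam0 lam1]; rewrite -subr_ge0.
have -> : p + (q - p) * lam - (a + (b - a) * lam) = (1 - lam) * (p - a) + lam * (q - b) by ring.
by rewrite addr_ge0 // mulr_ge0 // subr_ge0.
Qed.

Lemma knots_nat n : knots (fun k => k%:R : R) n.
Proof. by move=> i _; rewrite ltr_nat. Qed.

Lemma interp_nat_le (V W : nat -> R) n u : (0 < n)%N -> (forall k, (k <= n)%N -> V k <= W k) ->
  0 <= u -> interp (fun k => k%:R) V n u <= interp (fun k => k%:R) W n u.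
Proof.
move=> n0 VW u0; have [k [kn ku uk]] := knots_cell (tau := fun k => k%:R) n0 u0.
case: (le_or_lt n%:R u) => nu; first by rewrite !interp_top //; [exact: VW|exact: knots_nat|exact: knots_nat].
have uk1 : k%:R <= u <= k.+1%:R.
  rewrite ku; have [/uk/ltW //|] := boolP (k.+1 < n)%N.
  by rewrite -leqNgt -(ler_nat R); rlra.
rewrite !(interp_cell _ (@knots_nat n) kn uk1) -natrB // subSnn divr1.
by apply: convex_le; [exact/VW/ltnW|exact: VW|move: uk1; rewrite -natr1; rlra].
Qed.

Lemma interp_nat_cst p n u : (0 < n)%N -> 0 <= u ->
  interp (fun k => k%:R) (fun=> p) n u = p.
Proof.
move=> n0 u0; have [k [kn ku uk]] := knots_cell (tau := fun k => k%:R) n0 u0.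
case: (le_or_lt n%:R u) => nu; first by rewrite interp_top //; exact: knots_nat.
have uk1 : k%:R <= u <= k.+1%:R.
  rewrite ku; have [/uk/ltW //|] := boolP (k.+1 < n)%N.
  by rewrite -leqNgt -(ler_nat R); rlra.
by rewrite (interp_cell _ (@knots_nat n) kn uk1) subrr mul0r addr0.
Qed.

Lemma interp_nat_bounds (V : nat -> R) (I : nat -> nat) p q n u : (0 < n)%N ->
  (forall i, p <= V i <= q) -> 0 <= u ->
  p <= interp (fun k => k%:R) (fun k => V (I k)) n u <= q.
Proof.
move=> n0 Vpq u0; have hp := interp_nat_cst p n0 u0; have hq := interp_nat_cst q n0 u0.
apply/andP; split; [rewrite -hp|rewrite -hq];
  by apply: interp_nat_le => // k _; have /andP[] := Vpq (I k).
Qed.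

(** The extra knot [N.+1] sits at 2, the far edge of the square, where the arms are prolonged to
    their extreme values. *)
Definition grid N i : R := if (i <= N)%N then i%:R / N%:R else 2.

Lemma cell_close a b d p u v w : a <= b <= a + w -> a + u <= p <= b + v ->
  0 <= u -> v <= w -> w + w < d -> `|a - p| < d /\ `|b - p| < d.
Proof. by rewrite !ltr_norml => *; split; lra. Qed.

(* An arm of the planar map: [a] is the time at which the arm is traversed, and
   [v] the value attained at a given time. *)
Record arm F e p (a v : R -> R) : Prop := Arm {
  arm_continuous : continuous a /\ continuous v;
  arm_origin : a 0 = 0 /\ v 0 = F 0;
  arm_duration : forall x, 0 <= x <= 2 -> 0 <= a x <= p;
  arm_inj : forall x y, 0 <= x <= 2 -> 0 <= y <= 2 -> a x = a y -> x = y;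
  arm_start : forall u, 0 <= u <= 1 -> `|v u - F 0| < e;
  arm_close : forall x, 0 <= x <= 1 -> `|v (a x) - F x| < e;
  arm_bounds : forall u, 0 <= u -> - 1 <= v u <= 1 + e }.

Section Arm.
Variables (F : R -> R) (N K : nat) (I : nat -> nat) (V : nat -> R) (c d e : R).
Hypotheses (N0 : (0 < N)%N) (c0 : 0 < c) (cK : c * K%:R <= N%:R^-1) (Nd : 2 / N%:R < d).
Hypotheses (I0 : I 0%N = 0%N) (IK : I K = N.+1).
Hypothesis (Istep : forall k, (k < K)%N -> (I k <= I k.+1 <= (I k).+1)%N).
Hypothesis (VF : forall i, (i <= N)%N -> V i = F (i%:R / N%:R)).
Hypothesis (Fd : forall x y, 0 <= x <= 1 -> 0 <= y <= 1 -> `|x - y| < d -> `|F x - F y| < e).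

(** A climber may wait, so [I k] can repeat; the drift [c * k%:R], at most [1 / N] in total, makes
    the knots strictly increasing. *)
Let A k := grid N (I k) + c * k%:R.

Lemma gridN0 : 0 < N%:R :> R. Proof. by rewrite ltr0n. Qed.

Lemma grid_mono i j : (i <= j)%N -> grid N i <= grid N j.
Proof.
have NR := gridN0; rewrite /grid => ij; case: (leqP j N) => jN.
  by rewrite (leq_trans ij jN) ler_pM2r ?invr_gt0 // ler_nat.
case: ifP => // iN; have : i%:R / N%:R <= 1 :> R by rewrite ler_pdivrMr // mul1r ler_nat.
by lra.
Qed.

Lemma arm_knots : knots A K.
Proof.
move=> k kK; have /andP[Ik _] := Istep kK.
by apply: ler_ltD; [exact: grid_mono|rewrite ltr_pM2l // ltr_nat].
Qed.

Lemma arm_knots0 : A 0%N = 0.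
Proof. by rewrite /A /grid I0 /= mul0r mulr0 addr0. Qed.

Lemma arm_knotsK : 2 <= A K.
Proof. by rewrite /A IK /grid ltnn lerDl mulr_ge0 // ltW. Qed.

Lemma arm_K0 : (0 < K)%N.
Proof.
by rewrite lt0n; apply/eqP => K0; have := arm_knotsK; rewrite K0 arm_knots0; lra.
Qed.

Lemma arm_cell p : 0 <= p <= 2 -> exists2 k, (k < K)%N & A k <= p <= A k.+1.
Proof.
move=> p02; have [|k [kK kp pk]] := knots_cell (tau := A) (x := p) arm_K0.
  by rewrite arm_knots0; lra.
exists k => //; rewrite kp; have [/pk/ltW //|] := boolP (k.+1 < K)%N.
rewrite -leqNgt => Kk; have <- : K = k.+1 by apply/eqP; rewrite eqn_leq kK Kk.
by have := arm_knotsK; lra.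
Qed.

Definition arm_time p := interp A (fun k => k%:R) K p.
Definition arm_value u := interp (fun k => k%:R) (fun k => V (I k)) K u.

Lemma arm_time_cell p : 0 <= p <= 2 ->
  exists k lam, [/\ (k < K)%N, A k <= p <= A k.+1, 0 <= lam <= 1 & arm_time p = k%:R + lam].
Proof.
move=> p02; have [k kK kp] := arm_cell p02.
have [lam lam01 e1] := interp_between (fun k => k%:R) arm_knots kK kp.
by exists k, lam; split => //; rewrite /arm_time e1 -natrB ?leqnSn // subSnn mul1r.
Qed.

Lemma arm_time_bound p : 0 <= p <= 2 -> 0 <= arm_time p <= K%:R.
Proof.
move=> /arm_time_cell[k [lam [kK _ lam01 ->]]].
have : (k.+1%:R : R) <= K%:R by rewrite ler_nat.
by rewrite -natr1; have : (0 : R) <= k%:R by []; lra.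
Qed.

Lemma arm_time_inj p q : 0 <= p <= 2 -> 0 <= q <= 2 -> arm_time p = arm_time q -> p = q.
Proof.
have lt x y : 0 <= x <= 2 -> 0 <= y <= 2 -> x < y -> arm_time x < arm_time y.
  move=> x02 y02 xy; apply: (interp_lt arm_knots (@knots_nat K)).
    by rewrite arm_knots0; lra.
  by have := arm_knotsK; lra.
move=> p02 q02 pq; case: (ltgtP p q) => // h.
  by have := lt _ _ p02 q02 h; rewrite pq ltxx.
by have := lt _ _ q02 p02 h; rewrite pq ltxx.
Qed.

Lemma arm_time0 : arm_time 0 = 0.
Proof.
rewrite /arm_time (interp_cell _ arm_knots arm_K0) arm_knots0.
  by rewrite subrr mul0r mulr0 addr0.
by rewrite lexx -[X in X <= _]arm_knots0 ltW // arm_knots // arm_K0.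
Qed.

Lemma arm_approx p : 0 <= p <= 1 -> `|arm_value (arm_time p) - F p| < e.
Proof.
move=> p01; have [|k [lam [kK kp lam01 ->]]] := @arm_time_cell p; first lra.
have kl : k%:R <= k%:R + lam <= k.+1%:R by rewrite -natr1; lra.
have [mu mu01] := interp_between (fun k => V (I k)) (@knots_nat K) kK kl.
rewrite /arm_value => ->; have NR := gridN0; have Ni : 0 < N%:R^-1 :> R by rewrite invr_gt0.
have /andP[I1 I2] := Istep kK.
have ck : 0 <= c * k%:R by rewrite mulr_ge0 // ltW.
have Ik : (I k <= N)%N.
  by rewrite leqNgt; apply/negP => Ik; move: kp; rewrite /A /grid leqNgt Ik /=; lra.
(* A step to the knot at 2 starts from [I k = N], where the drift has already pushed [A k] beyond 1
   and so beyond [p]. *)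
have Ik1 : (I k.+1 <= N)%N.
  rewrite leqNgt; apply/negP => NI.
  have IkN : I k = N by apply/eqP; rewrite eqn_leq Ik -ltnS (leq_trans NI I2).
  have k0 : (0 < k)%N by rewrite lt0n; apply/eqP => k0; move: IkN N0; rewrite k0 I0 => <-.
  have : 0 < c * k%:R by rewrite mulr_gt0 // ltr0n.
  by move: kp; rewrite /A /grid IkN leqnn divff ?gt_eqF //; lra.
have ck1 : c * k.+1%:R <= N%:R^-1.
  by apply: le_trans cK; rewrite ler_pM2l // ler_nat.
move: kp; rewrite /A /grid Ik Ik1 !VF //.
set a := (I k)%:R / N%:R; set b := (I k.+1)%:R / N%:R => kp.
have ab : a <= b <= a + N%:R^-1.
  apply/andP; split; first by rewrite ler_pM2r // ler_nat.
  by rewrite -[X in _ + X]mul1r -mulrDl ler_pM2r // natr1 ler_nat.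
have a01 : 0 <= a <= 1.
  by rewrite divr_ge0 //= ler_pdivrMr // mul1r ler_nat.
have b01 : 0 <= b <= 1.
  by rewrite divr_ge0 //= ler_pdivrMr // mul1r ler_nat.
have Nd' : N%:R^-1 + N%:R^-1 < d by move: Nd; rewrite mulr2n mulrDl mul1r.
have [ap bp] := cell_close ab kp ck ck1 Nd'.
by apply: convex_norm_lt => //; apply: Fd => //; lra.
Qed.

Lemma arm_value_start u : 0 <= u <= 1 -> `|arm_value u - F 0| < e.
Proof.
move=> u01; have K0 := arm_K0; have NR := gridN0.
have Ni : 0 < N%:R^-1 :> R by rewrite invr_gt0.
have u01' : 0%:R <= u <= 1%:R by [].
have [mu mu01] := interp_between (fun k => V (I k)) (@knots_nat K) K0 u01'.
rewrite /arm_value => ->; have /andP[_ I1] := Istep K0; rewrite I0 in I1.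
have I1N : (I 1%N <= N)%N by apply: leq_trans I1 N0.
rewrite I0 !VF // mul0r; apply: convex_norm_lt => //.
  by apply: Fd; rewrite ?subrr ?normr0 ?lexx ?ler01 //; apply: lt_trans Nd; rewrite divr_gt0.
have i1 : 0 <= ((I 1%N)%:R / N%:R : R) <= N%:R^-1.
  by rewrite divr_ge0 //= -[leRHS]mul1r ler_pM2r // lern1.
have N1 : N%:R^-1 <= 1 :> R by rewrite invf_le1 // ler1n.
have [i10 i1N] := andP i1.
apply: Fd; [by rewrite i10 (le_trans i1N N1)|by rewrite lexx ler01|].
rewrite subr0 ger0_norm //; apply: le_lt_trans i1N (lt_trans _ Nd).
by rewrite -[ltLHS]mul1r ltr_pM2r // ltr1n.
Qed.

Lemma arm_exists : (forall i, - 1 <= V i <= 1 + e) ->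
  arm F e K%:R arm_time arm_value.
Proof.
move=> Vb; have K0 := arm_K0; split.
- by split; exact: continuous_interp.
- split; first exact: arm_time0.
  rewrite /arm_value (interp_cell _ (@knots_nat K) K0) ?lexx ?ler01 //=.
  by rewrite subr0 mul0r mulr0 addr0 I0 VF // mul0r.
- exact: arm_time_bound.
- exact: arm_time_inj.
- exact: arm_value_start.
- exact: arm_approx.
- by move=> u u0; exact: interp_nat_bounds.
Qed.

End Arm.

Definition bend x : R * R := (pos (- x), pos x).
Definition square z : Prop := 0 <= z.1 <= 2 /\ 0 <= z.2 <= 2.
Definition close2 e z w : Prop := `|z.1 - w.1| <= e /\ `|z.2 - w.2| <= e.

Lemma posP x : 0 <= x /\ pos x = x \/ x <= 0 /\ pos x = 0.
Proof.
case: (le_or_lt 0 x) => h; [left|right]; first by rewrite pos_ge0.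
by rewrite pos_le0 ltW.
Qed.

(** Minimum and difference of the coordinates recover [s] and [u]: the diagonal translates of the
    bent line are disjoint. *)
Lemma pos_add_inj u v s t : pos (- u) + s = pos (- v) + t -> pos u + s = pos v + t ->
  u = v /\ s = t.
Proof.
by have := posP u; have := posP (- u); have := posP v; have := posP (- v); split; lra.
Qed.

Lemma pos_add_bounds u s : u <= 3 / 2 -> 0 <= s <= 1 / 2 -> 0 <= pos u + s <= 2.
Proof. by have := posP u; lra. Qed.

Lemma pos_add_close u v s d e : `|u - v| <= d -> 0 <= s -> d + s <= e ->
  `|pos u + s - pos v| <= e.
Proof. by rewrite !ler_norml; have := posP u; have := posP v; lra. Qed.

Lemma bend_square y : - 1 <= y <= 1 -> square (bend y).
Proof.
by move=> y1; rewrite /square /bend /=; have := posP y; have := posP (- y); lra.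
Qed.

Lemma grid_approx N y : (0 < N)%N -> 0 <= y <= 1 -> forall j, (j <= N)%N -> y <= j%:R / N%:R ->
  exists2 k, (k <= j)%N & k%:R / N%:R <= y <= k%:R / N%:R + N%:R^-1.
Proof.
move=> N0 y01; have NR : 0 < N%:R :> R by rewrite ltr0n.
have Ni : 0 < N%:R^-1 :> R by rewrite invr_gt0.
elim=> [|j IH] jN yj; first by exists 0%N => //; move: yj; rewrite mul0r; rlra.
case: (le_or_lt y (j%:R / N%:R)) => h.
  by have [k kj hk] := IH (ltnW jN) h; exists k => //; exact: leqW.
by exists j => //; move: yj; rewrite -natr1 mulrDl mul1r; rlra.
Qed.

End PlanarArms.

(** * The planar step for a single map *)

Section PlanarStep.
Variable R : realType.
Implicit Types (F G : R -> R) (I J : nat -> nat) (i j k n N : nat).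
Implicit Types (c d e p q u x y : R) (z w : R * R).

Section Arms.
Variables (G : R -> R) (e : R).
Hypotheses (cG : continuous G) (uG : unit_map G) (e0 : 0 < e).
Hypothesis nd : forall x1 x2, 0 <= x1 <= 1 -> 0 <= x2 <= 1 -> ~ negative_departure G x1 x2.

Let FL x := G (- x).
Let FU x := G x + e.
(** Beyond the samples [L] drops to -1 and [U] rises to [1 + e], the extreme values that
    [lattice_path] demands at the final position. *)
Let L N i := if (i <= N)%N then FL (i%:R / N%:R) else - 1.
Let U N j := if (j <= N)%N then FU (j%:R / N%:R) else 1 + e.

Lemma fraction_unit i N : (0 < N)%N -> (i <= N)%N -> 0 <= (i%:R / N%:R : R) <= 1.
Proof.
by move=> N0 iN; rewrite divr_ge0 //= ler_pdivrMr ?ltr0n // mul1r ler_nat.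
Qed.

Lemma lower_bounds N i : (0 < N)%N -> - 1 <= L N i <= 1.
Proof.
rewrite /L => N0; case: ifP => iN; last by lra.
by apply: uG; have := fraction_unit N0 iN; lra.
Qed.

Lemma upper_bounds N j : (0 < N)%N -> - 1 + e <= U N j <= 1 + e.
Proof.
rewrite /U => N0; case: ifP => jN; last by lra.
have /uG : - 1 <= (j%:R / N%:R : R) <= 1 by have := fraction_unit N0 jN; lra.
by rewrite /FU; lra.
Qed.

(** The gap [e] between [FU] and [G] outweighs the variation of [G] between neighbouring grid
    points, so a lattice departure would be a negative departure of [G]. *)
Lemma arms_departure N d i j : (0 < N)%N -> N%:R^-1 < d ->
  (forall x y, - 1 <= x <= 1 -> - 1 <= y <= 1 -> `|x - y| < d -> `|G x - G y| < e) ->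
  ~ lattice_departure (L N) (U N) i j.
Proof.
move=> N0 Nd hd [d1 d2]; have e_gt0 := e0.
have iN : (i <= N)%N.
  rewrite leqNgt; apply/negP => iN; have LE : L N i = - 1 by rewrite /L leqNgt iN.
  by have := d1 0%N (leq0n _); rewrite LE; have := upper_bounds 0%N N0; lra.
have jN : (j <= N)%N.
  rewrite leqNgt; apply/negP => jN; have UE : U N j = 1 + e by rewrite /U leqNgt jN.
  by have := d2 0%N (leq0n _); rewrite UE; have := lower_bounds 0%N N0; lra.
have near y n : (n <= N)%N -> 0 <= y <= n%:R / N%:R ->
    exists k, [/\ (k <= n)%N, (k <= N)%N, `|G y - G (k%:R / N%:R)| < e &
      `|G (- y) - G (- (k%:R / N%:R))| < e].
  move=> nN /andP[y0 yn]; have gn := fraction_unit N0 nN.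
  have y01 : 0 <= y <= 1 by rlra.
  have [k kn hk] := @grid_approx R N y N0 y01 n nN yn.
  have kN := leq_trans kn nN; have gk := fraction_unit N0 kN.
  suff : forall x, x <= y <= x + N%:R^-1 -> 0 <= x <= 1 ->
      `|G y - G x| < e /\ `|G (- y) - G (- x)| < e.
    by move=> /(_ _ hk gk)[h1 h2]; exists k.
  move=> {hk gk}x hk gk.
  have [x1 y1 xy] : [/\ - 1 <= x <= 1, - 1 <= y <= 1 & `|y - x| < d].
    by split; [lra|lra|rewrite ltr_norml; lra].
  split; first exact: hd.
  by apply: hd; [lra|lra|rewrite -opprB normrN opprK addrC].
apply: (nd (fraction_unit N0 iN) (fraction_unit N0 jN)); split=> y /near.
  move=> /(_ jN)[k [kj kN h _]]; have := d1 k kj; rewrite /U /L kN iN /FU /FL.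
  by move: h; rewrite ltr_norml; lra.
move=> /(_ iN)[k [ki kN _ h]]; have := d2 k ki; rewrite /U /L kN jN /FU /FL.
by move: h; rewrite ltr_norml; lra.
Qed.

Lemma arms_exist : exists p a b (l r : R -> R), [/\ 0 < p, arm FL e p a l, arm FU e p b r &
  forall u, 0 <= u -> l u <= r u].
Proof.
have [d d0 hd] := uniform_modulus (-1) 1 cG e0.
have [N N0 Nd] : exists2 N, (0 < N)%N & 2 / N%:R < d.
  have [N hN] : exists N, 2 / d < N%:R :> R.
    exists (Num.truncn (2 / d)).+1; exact: truncnS_gt.
  have NR : 0 < N%:R :> R by apply: lt_trans hN; rewrite divr_gt0.
  exists N; first by rewrite ltr0n in NR.
  by rewrite ltr_pdivrMr // mulrC -ltr_pdivrMr.
have NR : 0 < N%:R :> R by rewrite ltr0n.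
have Nid : N%:R^-1 < d.
  by apply: lt_trans Nd; rewrite -[ltLHS]mul1r ltr_pM2r ?invr_gt0 // ltr1n.
have e_gt0 := e0; have Lb i := lower_bounds i N0; have Ub i := upper_bounds i N0.
have [K [I [J [[I0 J0] [IK JK] st LU]]]] : exists K I J,
    [/\ I 0%N = 0%N /\ J 0%N = 0%N, I K = N.+1 /\ J K = N.+1,
      forall k, (k < K)%N -> lattice_step I J k &
      forall k, (k <= K)%N -> L N (I k) <= U N (J k)].
  apply: reach_sequence; apply: lattice_path.
  - by move=> i _; rewrite {1}/L ltnn; have := Lb i; lra.
  - by move=> j _; rewrite {1}/L ltnn; have := Ub j; lra.
  - by move=> i _; rewrite {1}/U ltnn; have := Lb i; lra.
  - by move=> j _; rewrite {2}/U ltnn; have := Ub j; lra.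
  - by move=> i j _ _; exact: arms_departure Nid hd.
have Is k : (k < K)%N -> (I k <= I k.+1 <= (I k).+1)%N.
  by move=> /st[[-> _]|[-> _]]; rewrite ?leqnn ?leqnSn.
have Js k : (k < K)%N -> (J k <= J k.+1 <= (J k).+1)%N.
  by move=> /st[[_ ->]|[_ ->]]; rewrite ?leqnn ?leqnSn.
have K0 : (0 < K)%N by rewrite lt0n; apply/eqP => K0; move: IK; rewrite K0 I0.
have KR : 0 < K%:R :> R by rewrite ltr0n.
have [c [c0 cK]] : exists c : R, 0 < c /\ c * K%:R <= N%:R^-1.
  exists (N%:R * K%:R)^-1; rewrite invr_gt0 mulr_gt0 //; split => //.
  by rewrite invfM -mulrA mulVf ?mulr1 // gt_eqF.
have dL x y : 0 <= x <= 1 -> 0 <= y <= 1 -> `|x - y| < d -> `|FL x - FL y| < e.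
  by move=> x01 y01 xy; apply: hd; [rlra|rlra|rewrite -opprD normrN].
have dU x y : 0 <= x <= 1 -> 0 <= y <= 1 -> `|x - y| < d -> `|FU x - FU y| < e.
  by move=> x01 y01 xy; rewrite /FU opprD addrACA subrr addr0; apply: hd; rlra.
have LF i : (i <= N)%N -> L N i = FL (i%:R / N%:R) by move=> iN; rewrite /L iN.
have UF i : (i <= N)%N -> U N i = FU (i%:R / N%:R) by move=> iN; rewrite /U iN.
exists K%:R, (arm_time N K I c), (arm_time N K J c), (arm_value K I (L N)), (arm_value K J (U N)).
split => //.
- by apply: (arm_exists N0 c0 cK Nd I0 IK Is LF dL) => i; have := Lb i; lra.
- by apply: (arm_exists N0 c0 cK Nd J0 JK Js UF dU) => i; have := Ub i; lra.
- by move=> u u0; exact: interp_nat_le.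
Qed.

End Arms.

Lemma start_close a p q c g e : `|p| < e -> `|q - e| < e -> p <= c <= q ->
  `|a - g| < e -> - e < a < 2 * e -> `|c - g| <= 4 * e.
Proof. by rewrite !ltr_norml ler_norml; lra. Qed.

Lemma planar_step G e : continuous G -> G 0 = 0 -> unit_map G ->
  (forall x1 x2, 0 <= x1 <= 1 -> 0 <= x2 <= 1 -> ~ negative_departure G x1 x2) -> 0 < e ->
  exists H : R * R -> R * R,
    [/\ continuous H, H (0, 0) = (0, 0), forall z, square z -> square (H z),
        forall z w, square z -> square w -> H z = H w -> z = w &
        forall y, - 1 <= y <= 1 -> close2 e (H (bend y)) (bend (G y))].
Proof.
move=> cG G0 uG nd e0.
(* The final error is at most [5 * eta + eta / 2], and [eta <= 1 / 8] keeps the image inside the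
   square. *)
have [eta [eta0 etae eta1]] : exists eta, [/\ 0 < eta, eta * 8 <= e & eta * 8 <= 1].
  by exists (Num.min e 1 / 8); rewrite minEle; case: ifP => ?; split; lra.
have [K [a [b [l [r [K0 armL armU lr]]]]]] := arms_exist cG uG eta0 nd.
have [[ca cl] [a0 l0] aK aI ls la lb] := armL.
have [[cb cr] [b0 r0] bK bI rs rb rbd] := armU.
(* As [T] is at most [2 * K] and [X] at most [K] in absolute value, the terms [kap * T] and
   [kap * X] stay within [eta / 2] and [eta / 4]. *)
pose kap := eta / (4 * K).
have kap0 : 0 < kap by rewrite divr_gt0 // mulr_gt0.
have kapK : kap * K = eta / 4 by rewrite /kap; field; rewrite gt_eqF.
(* T is the total time and X the signed time spent on the arms.  At time T the
   image lies on the copy of the bent line at distance kap * T from the axes, at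
   the position 2 X clamped to [l T, r T]; the term kap * X restores injectivity. *)
pose T z := a z.1 + b z.2; pose X z := b z.2 - a z.1.
pose C z := Num.max (l (T z)) (Num.min (r (T z)) (2 * X z)).
pose g z := C z + kap * X z.
pose H z := (pos (- g z) + kap * T z, pos (g z) + kap * T z).
have calpha : continuous (fun z => a z.1).
  by apply: (continuous_compU (f := fst)) => // z; exact: cvg_fst.
have cbeta : continuous (fun z => b z.2).
  by apply: (continuous_compU (f := snd)) => // z; exact: cvg_snd.
have cT : continuous T by move=> z; apply: cvgD; [exact: calpha|exact: cbeta].
have cX : continuous X by move=> z; apply: cvgB; [exact: cbeta|exact: calpha].
have cg : continuous g.
  have c2 : continuous (fun z => 2 * X z) by move=> z; apply: cvgM; [exact: cvg_cst|exact: cX].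
  have cC : continuous C.
    exact: continuous_maxr (continuous_compU cT cl) (continuous_minr (continuous_compU cT cr) c2).
  by move=> z; apply: cvgD; [exact: cC|apply: cvgM; [exact: cvg_cst|exact: cX]].
have Cb z : 0 <= T z -> l (T z) <= C z <= r (T z).
  by move=> /lr lrT; exact: clamp_between.
have TX z : square z -> 0 <= T z <= 2 * K /\ - K <= X z <= K.
  move=> [/aK ha /bK hb]; rewrite /T /X; move: (a _) (b _) ha hb => u v hu hv; rlra.
have kapTX z : square z -> 0 <= kap * T z <= eta / 2 /\ - (eta / 4) <= kap * X z <= eta / 4.
  by move=> /TX[h1 h2]; exact: (scaled_bounds kap0 kapK h1 h2).
have HE z : H z = (pos (- g z) + kap * T z, pos (g z) + kap * T z) by [].
have gE z : g z = C z + kap * X z by [].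
exists H; split.
- have cN : continuous (fun z => - g z) by move=> z; apply: cvgN; exact: cg.
  have cK : continuous (fun z => kap * T z) by move=> z; apply: cvgM; [exact: cvg_cst|exact: cT].
  have c1 : continuous (fun z => pos (- g z) + kap * T z).
    by move=> z; apply: cvgD; [exact: (continuous_pos cN)|exact: cK].
  have c2 : continuous (fun z => pos (g z) + kap * T z).
    by move=> z; apply: cvgD; [exact: (continuous_pos cg)|exact: cK].
  exact: (continuous_pairing c1 c2).
- have gz : g (0, 0) = 0.
    rewrite /g /C /T /X /= a0 b0 addr0 subrr !mulr0 addr0 l0 r0 oppr0 G0 add0r.
    by rewrite (min_idPr (ltW eta0)) maxxx.
  by rewrite HE gz oppr0 /T /= a0 b0 addr0 mulr0 !pos_le0 ?addr0.
- move=> z sz; have [[T0 _] [h1 h2]] := (andP (proj1 (TX z sz)), kapTX z sz).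
  have [hC hl hr] := And3 (Cb z T0) (lb _ T0) (rbd _ T0).
  rewrite HE gE; move: (l _) (r _) (C z) (kap * X z) (kap * T z) hC hl hr h1 h2.
  by move=> p q u v s hC hl hr h1 h2; split; apply: pos_add_bounds; rlra.
- move=> z w sz sw [h1 h2]; have [gg kT] := pos_add_inj h1 h2.
  have TT : T z = T w by apply: mulfI kT; rewrite gt_eqF.
  have XX : X z = X w.
    have : 2 * X z = 2 * X w.
      apply: (@clamp_inj _ (l (T z)) (r (T z)) (kap / 2)); first by rewrite divr_gt0.
      by move: gg; rewrite !gE /C -TT !mulrA divfK.
    by apply: mulfI.
  have [[z1 z2] [w1 w2]] := (sz, sw).
  have [aa bb] : a z.1 = a w.1 /\ b z.2 = b w.2.
    move: TT XX; rewrite /T /X.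
    by move: (a z.1) (b z.2) (a w.1) (b w.2) => p q u v h h'; split; rlra.
  rewrite [z]surjective_pairing [w]surjective_pairing.
  by rewrite (aI _ _ z1 w1 aa) (bI _ _ z2 w2 bb).
- move=> y y1; have sy := bend_square y1; have [hT hX] := kapTX _ sy.
  have [T0 _] := andP (proj1 (TX _ sy)).
  suff gy : `|C (bend y) - G y| <= 4 * eta.
    have {gy} gy : `|g (bend y) - G y| <= 5 * eta.
      move: gy hX; rewrite gE !ler_norml.
      by move: (C _) (kap * X _) (G y) => p q u h h'; rlra.
    have [kT0 kT5] : 0 <= kap * T (bend y) /\ 5 * eta + kap * T (bend y) <= e.
      by move: hT; move: (kap * T _) => u hu; split; rlra.
    rewrite HE; split; apply: pos_add_close kT0 kT5 => //.
    by rewrite -opprD normrN.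
  have hC := Cb _ T0; have [hl hr] := (lb _ T0, rbd _ T0); have hlr := lr _ T0.
  have start : T (bend y) <= 1 -> `|l (T (bend y))| < eta /\ `|r (T (bend y)) - eta| < eta.
    move=> T1; have T01 : 0 <= T (bend y) <= 1 by rewrite T0.
    by move: (ls _ T01) (rs _ T01); rewrite oppr0 G0 add0r subr0.
  (* On the axes [X] is [T] or [- T]. Past time 1, [2 * X] leaves [[l, r]], which lies in
     [[-1, 1 + eta]], so [C] is the height of the moving arm; until then [l], [r] and the target are
     all within a few [eta] of 0. *)
  case: (le_or_lt 0 y) => y0.
    have [TE XE] : T (bend y) = b y /\ X (bend y) = b y.
      by rewrite /T /X /bend /= pos_le0 ?oppr_le0 // pos_ge0 // a0 add0r subr0.
    have y01 : 0 <= y <= 1 by rlra.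
    have := rb _ y01; move: start hC; rewrite /C XE TE in T0 hl hr hlr *.
    move: (b y) (G y) (l _) (r _) T0 hl hr hlr => t u p q t0 hp hq pq start hC qu.
    case: (le_or_lt t 1) => t1.
      have [p0 q0] := start t1; apply: (@start_close (q - eta) p q) => //.
        by move: qu; rewrite !ltr_norml; rlra.
      by move: q0; rewrite ltr_norml; rlra.
    rewrite clamp_hi //; last by rlra.
    by move: qu; rewrite ltr_norml ler_norml; rlra.
  have [TE XE] : T (bend y) = a (- y) /\ X (bend y) = - a (- y).
    rewrite /T /X /bend /= pos_ge0 ?oppr_ge0 ?ltW // pos_le0 ?ltW //.
    by rewrite b0 addr0 sub0r.
  have y01 : 0 <= - y <= 1 by rlra.
  have := la _ y01; rewrite opprK; move: start hC; rewrite /C XE TE in T0 hl hr hlr *.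
  move: (a (- y)) (G y) (l _) (r _) T0 hl hr hlr => t u p q t0 hp hq pq start hC pu.
  case: (le_or_lt t 1) => t1.
    have [p0 q0] := start t1; apply: (@start_close p p q) => //.
    by move: p0; rewrite ltr_norml; rlra.
  rewrite clamp_lo //; last by rlra.
  by move: pu; rewrite ltr_norml ler_norml; rlra.
Qed.

End PlanarStep.

(** * The embedding *)

Section PlanarLimit.
Variable R : realType.
Implicit Types (E H : R * R -> R * R) (b e u v x y : R) (z w p q : R * R) (i j k n : nat).

Lemma close2_trans e e' p q w : close2 e p q -> close2 e' q w -> close2 (e + e') p w.
Proof. by rewrite /close2 !ler_norml => -[h1 h2] [h3 h4]; split; lra. Qed.

Lemma close2_sym e p q : close2 e p q -> close2 e q p.
Proof. by rewrite /close2 ![`|q.1 - _|]distrC ![`|q.2 - _|]distrC. Qed.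

Definition dist2 z w : R := Num.max `|z.1 - w.1| `|z.2 - w.2|.

Lemma dist2_le e z w : (dist2 z w <= e) <-> close2 e z w.
Proof. by rewrite /dist2 ge_max; split=> [/andP[]|[-> ->]]. Qed.

Lemma dist2_ge0 z w : 0 <= dist2 z w.
Proof. by rewrite /dist2 le_max normr_ge0. Qed.

Lemma dist2_eq0 z w : dist2 z w = 0 -> z = w.
Proof.
move=> zw; have /dist2_le[] : dist2 z w <= 0 by rewrite zw.
rewrite !normr_le0 !subr_eq0 => /eqP e1 /eqP e2.
by rewrite [z]surjective_pairing [w]surjective_pairing e1 e2.
Qed.

Lemma continuous_dist2 (U : topologicalType) (f g : U -> R * R) :
  continuous f -> continuous g -> continuous (fun a : U => dist2 (f a) (g a)).
Proof.
move=> cf cg; have cp (h : R * R -> R) : continuous h ->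
    continuous (fun a : U => h (f a)) /\ continuous (fun a : U => h (g a)).
  by move=> ch; split; [exact: (continuous_compU cf)|exact: (continuous_compU cg)].
have [f1 g1] := cp fst (fun z => cvg_fst).
have [f2 g2] := cp snd (fun z => cvg_snd).
have n (h l : U -> R) : continuous h -> continuous l -> continuous (fun a : U => `|h a - l a|).
  by move=> ch cl a; apply: cvg_norm; apply: cvgB; [exact: ch|exact: cl].
exact: (continuous_maxr (n _ _ f1 g1) (n _ _ f2 g2)).
Qed.

Lemma continuous_bend : continuous (@bend R).
Proof.
apply: continuous_pairing; apply: continuous_pos; first exact: opp_continuous.
by move=> ?; exact: cvg_id.
Qed.

Lemma bend_inj y y' : bend y = bend y' -> y = y'.
Proof.
move=> [h1 h2]; have := posP y; have := posP (- y); have := posP y'; have := posP (- y').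
lra.
Qed.

Variable G : nat -> R -> R.
Hypotheses (cG : forall k, continuous (G k)) (G0 : forall k, G k 0 = 0).
Hypothesis (uG : forall k, unit_map (G k)).
Hypothesis (nd : forall k x1 x2, 0 <= x1 <= 1 -> 0 <= x2 <= 1 ->
  ~ negative_departure (G k) x1 x2).

(** The entries of a thread below index [k] are determined by the [k]-th one; the sum collects the
    differences of them all, so one bound controls every entry. *)
Fixpoint spread k u v : R :=
  (if k is j.+1 then spread j (G j u) (G j v) else 0) + `|u - v|.

Lemma continuous_spread k : continuous (fun z : R * R => spread k z.1 z.2).
Proof.
have cn : continuous (fun z : R * R => `|z.1 - z.2|).
  by move=> z; apply: cvg_norm; apply: cvgB; [exact: cvg_fst|exact: cvg_snd].
elim: k => [|k IH] z /=; apply: cvgD; try exact: cn; first exact: cvg_cst.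
have c1 : continuous (fun z : R * R => G k z.1).
  by apply: (continuous_compU (f := fst)); [move=> ?; exact: cvg_fst|exact: cG].
have c2 : continuous (fun z : R * R => G k z.2).
  by apply: (continuous_compU (f := snd)); [move=> ?; exact: cvg_snd|exact: cG].
exact: (continuous_compU (continuous_pairing c1 c2) IH).
Qed.

Lemma spreadxx k u : spread k u u = 0.
Proof. by elim: k u => [|k IH] u /=; rewrite ?IH subrr normr0 addr0. Qed.

Lemma spread_ge0 k u v : 0 <= spread k u v.
Proof. by elim: k u v => [|k IH] u v /=; rewrite addr_ge0. Qed.

Definition thread (y : nat -> R) := forall k, - 1 <= y k <= 1 /\ G k (y k.+1) = y k.

Lemma spread_thread (y y' : nat -> R) i k : thread y -> thread y' -> (i <= k)%N ->
  `|y i - y' i| <= spread k (y k) (y' k).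
Proof.
move=> ty ty'; elim: k => [|k IH]; first by rewrite leqn0 => /eqP -> /=; rewrite add0r.
rewrite leq_eqVlt => /orP[/eqP ->|]; first by rewrite lerDr spread_ge0.
rewrite ltnS => /IH ik; rewrite /= (proj2 (ty k)) (proj2 (ty' k)).
by apply: le_trans ik _; rewrite lerDl.
Qed.

(* The factor 3 leaves room for two approximation errors b. *)
Record stage k E b : Prop := Stage {
  stage_continuous : continuous E;
  stage0 : E (0, 0) = (0, 0);
  stage_square : forall z, square z -> square (E z);
  stage_inj : forall z w, square z -> square w -> E z = E w -> z = w;
  stage_gt0 : 0 < b;
  stage_separates : forall u v, - 1 <= u <= 1 -> - 1 <= v <= 1 ->
    close2 (3 * b) (E (bend u)) (E (bend v)) -> spread k u v < k.+1%:R^-1 }.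

Definition refines k E b E' b' :=
  b' <= b / 2 /\
  forall y, - 1 <= y <= 1 -> close2 (b / 2) (E' (bend y)) (E (bend (G k y))).

(** [E \o bend] is injective on a compact interval, so images closer than some [d] force a small
    [spread]; [b <= d / 4] gives [3 * b < d]. *)
Lemma stage_exists k E e : continuous E -> E (0, 0) = (0, 0) ->
  (forall z, square z -> square (E z)) ->
  (forall z w, square z -> square w -> E z = E w -> z = w) -> 0 < e ->
  exists2 b, b <= e & stage k E b.
Proof.
move=> cE E0 sqE injE e0; pose A := `[-1 : R, 1]%classic `*` `[-1 : R, 1]%classic.
have cEb : continuous (E \o @bend R) := continuous_compU continuous_bend cE.
have c1 : continuous (fun z => E (bend z.1)).
  by apply: (continuous_compU (f := fst) (g := E \o @bend R)) => // ?; exact: cvg_fst.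
have c2 : continuous (fun z => E (bend z.2)).
  by apply: (continuous_compU (f := snd) (g := E \o @bend R)) => // ?; exact: cvg_snd.
have k0 : 0 < k.+1%:R^-1 :> R by rewrite invr_gt0 ltr0n.
have cA : compact A by apply: compact_setX; exact: segment_compact.
have ge0 z : A z -> 0 <= dist2 (E (bend z.1)) (E (bend z.2)) by move=> _; exact: dist2_ge0.
have eq0 z : A z -> dist2 (E (bend z.1)) (E (bend z.2)) = 0 -> spread k z.1 z.2 = 0.
  rewrite /A /= !in_itv /= => -[z1 z2] /dist2_eq0 eqz.
  have /bend_inj -> := injE _ _ (bend_square z1) (bend_square z2) eqz.
  exact: spreadxx.
have [d d0 hd] := compact_modulus cA (continuous_dist2 c1 c2) (@continuous_spread k) ge0 eq0 k0.
exists (Num.min e (d / 4)); first by rewrite ge_min lexx.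
have [b0 bd] : 0 < Num.min e (d / 4) /\ 3 * Num.min e (d / 4) < d.
  by rewrite minEle; case: ifP => h; split; lra.
split => // u v u1 v1 /dist2_le uv; apply: (hd (u, v)); last exact: le_lt_trans uv bd.
by split; rewrite /= in_itv.
Qed.

(** [E'] is [E \o H] with [H] from [planar_step], whose precision comes from the uniform continuity
    of [E] on the square. *)
Lemma stage_step k E b : stage k E b ->
  exists E' b', stage k.+1 E' b' /\ refines k E b E' b'.
Proof.
move=> [cE E0 sqE injE b0 _].
pose A : set ((R * R) * (R * R)) :=
  (`[0 : R, 2]%classic `*` `[0 : R, 2]%classic) `*` (`[0 : R, 2]%classic `*` `[0 : R, 2]%classic).
have inA z w : square z -> square w -> A (z, w).
  by move=> [? ?] [? ?]; rewrite /A /= !in_itv.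
have cf : continuous (@fst (R * R)%type (R * R)%type) by move=> ?; exact: cvg_fst.
have cs : continuous (@snd (R * R)%type (R * R)%type) by move=> ?; exact: cvg_snd.
have b2 : 0 < b / 2 by rewrite divr_gt0.
have cA : compact A.
  by apply: compact_setX; apply: compact_setX; exact: segment_compact.
have ge0 (z : (R * R) * (R * R)) : A z -> 0 <= dist2 z.1 z.2 by move=> _; exact: dist2_ge0.
have eq0 (z : (R * R) * (R * R)) : A z -> dist2 z.1 z.2 = 0 -> dist2 (E z.1) (E z.2) = 0.
  move=> _ /dist2_eq0 ->; apply/eqP; rewrite eq_le dist2_ge0 andbT; apply/dist2_le.
  by rewrite /close2 !subrr normr0.
have [d d0 hd] := compact_modulus cA (continuous_dist2 cf cs)
  (continuous_dist2 (continuous_compU cf cE) (continuous_compU cs cE)) ge0 eq0 b2.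
have d20 : 0 < d / 2 by rewrite divr_gt0.
have [H [cH H0 sqH injH apH]] := planar_step (@cG k) (G0 k) (@uG k) (@nd k) d20.
have [|||||b' b'b st] := @stage_exists k.+1 (E \o H) (b / 2).
- exact: continuous_compU.
- by rewrite /= H0.
- by move=> z sz; apply/sqE/sqH.
- by move=> z w sz sw /injE zw; apply: injH => //; apply: zw; exact: sqH.
- by [].
exists (E \o H), b'; split => //; split => // y y1.
apply/dist2_le/ltW; apply: (hd (H (bend y), bend (G k y))).
  by apply: inA; [exact/sqH/bend_square|exact/bend_square/uG].
by apply: (@le_lt_trans _ _ (d / 2)); [exact/dist2_le/apH|rewrite ltr_pdivrMr //; lra].
Qed.

Lemma stages : exists (E : nat -> R * R -> R * R) (b : nat -> R), forall k,
  stage k (E k) (b k) /\ refines k (E k) (b k) (E k.+1) (b k.+1).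
Proof.
pose T := (nat * (R * R -> R * R) * R)%type.
pose good (s : T) := stage s.1.1 s.1.2 s.2.
(* Conditional on [good], so that the relation is total, as dependent choice requires. *)
pose next (s s' : T) := good s -> [/\ s'.1.1 = s.1.1.+1, good s' &
  refines s.1.1 s.1.2 s.2 s'.1.2 s'.2].
have step s : {s' | next s s'}.
  apply: cid; have [gs|ngs] := pselect (good s); last by exists s => /ngs.
  have [E' [b' [st ref]]] := stage_step gs.
  by exists (s.1.1.+1, E', b') => _; split.
have [|||||b0 _ st0] := @stage_exists 0 id 1 => //; first by move=> z; exact: cvg_id.
have [f [f0 fS]] := dependent_choice step (0%N, id, b0).
have gf k : (f k).1.1 = k /\ good (f k).
  elim: k => [|k [fk gk]]; first by rewrite f0.
  by have [-> ? _] := fS k gk; rewrite fk.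
exists (fun k => (f k).1.2), (fun k => (f k).2) => k; have [fk gk] := gf k.
have [_ _ ref] := fS k gk; move: gk ref; rewrite /good fk => gk ref; split => //.
Qed.

Lemma halving_small (b : nat -> R) e : (forall k, 0 < b k /\ b k.+1 <= b k / 2) -> 0 < e ->
  exists k, b k < e.
Proof.
move=> hb e0; have [b0 _] := hb 0%N.
have pow k : b k <= b 0%N / k.+1%:R.
  elim: k => [|k IH]; first by rewrite divr1.
  have [_ bk] := hb k; apply: (le_trans bk).
  rewrite ler_pdivlMr ?ltr0n // -mulrA.
  have k0 : 0 < k.+1%:R :> R by rewrite ltr0n.
  have : b k * k.+1%:R <= b 0%N by rewrite -ler_pdivlMr.
  have k1 : 1 <= k.+1%:R :> R by rewrite ler1n.
  have [bk0 _] := hb k; rewrite -[k.+2%:R]natr1.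
  by move: (k.+1%:R : R) k0 k1 => a a0 a1 h; nra.
exists (Num.truncn (b 0%N / e)); apply: le_lt_trans (pow _) _.
have := truncnS_gt (b 0%N / e).
by rewrite ltr_pdivrMr ?ltr_pdivrMr ?ltr0n // mulrC.
Qed.

(* The limit is the common point of the nested intervals [p k - b k, p k + b k]. *)
Lemma nested_limit (b p : nat -> R) : (forall k, 0 < b k /\ b k.+1 <= b k / 2) ->
  (forall k, `|p k.+1 - p k| <= b k / 2) -> exists x, forall k, `|x - p k| <= b k.
Proof.
move=> hb hp; have mono k m : p k - b k <= p (k + m)%N - b (k + m)%N /\
    p (k + m)%N + b (k + m)%N <= p k + b k.
  elim: m => [|m IH]; first by rewrite addn0.
  have [b0 b1] := hb (k + m)%N; have := hp (k + m)%N; rewrite addnS ler_norml.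
  by move=> h; lra.
have cross j k : p j - b j <= p k + b k.
  have [m1 _] := mono j (k - j)%N; have [_ m2] := mono k (j - k)%N.
  have [b0 _] := hb (maxn j k).
  have e1 : (j + (k - j))%N = maxn j k by rewrite maxnE.
  have e2 : (k + (j - k))%N = maxn j k by rewrite maxnC maxnE.
  by rewrite e1 in m1; rewrite e2 in m2; lra.
pose S := [set p k - b k | k in setT].
exists (sup S) => k; have ub : has_ubound S by exists (p 0%N + b 0%N) => _ [j _ <-].
have lo : p k - b k <= sup S by apply: ub_le_sup => //; exists k.
have hi : sup S <= p k + b k.
  by apply: ge_sup; [exists (p 0%N - b 0%N); exists 0%N|move=> _ [j _ <-]].
by rewrite ler_norml; lra.
Qed.

Lemma planar_limit : exists (E : nat -> R * R -> R * R) (b : nat -> R) (Psi : (nat -> R) -> R * R),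
  [/\ forall k, stage k (E k) (b k), forall e, 0 < e -> exists k, b k < e,
      forall (y : nat -> R) k, thread y -> close2 (b k) (Psi y) (E k (bend (y k))),
      Psi (fun=> 0) = (0, 0) & forall y : nat -> R, thread y -> 0 <= (Psi y).1 /\ 0 <= (Psi y).2].
Proof.
have [E [b hEb]] := stages.
have hb k : 0 < b k /\ b k.+1 <= b k / 2.
  by have [st [bb _]] := hEb k; split => //; exact: stage_gt0 st.
have lim (y : nat -> R) : exists z, thread y -> forall k, close2 (b k) z (E k (bend (y k))).
  have [ty|nty] := pselect (thread y); last by exists (0, 0).
  have st k : close2 (b k / 2) (E k.+1 (bend (y k.+1))) (E k (bend (y k))).
    have [_ [_ ref]] := hEb k; rewrite -(proj2 (ty k)); apply: ref.
    by have [] := ty k.+1.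
  have [x1 h1] := nested_limit hb (fun k => proj1 (st k)).
  have [x2 h2] := nested_limit hb (fun k => proj2 (st k)).
  by exists (x1, x2) => _ k; split; [exact: h1|exact: h2].
have [Psi hPsi] := choice lim.
have small e : 0 < e -> exists k, b k < e by exact: halving_small hb.
exists E, b, Psi; split => //.
- by move=> k; have [] := hEb k.
- by move=> y k ty; exact: hPsi.
- have t0 : thread (fun=> 0) by move=> k; split => //; lra.
  have bend0 : bend 0 = (0, 0) :> R * R by rewrite /bend oppr0 pos_ge0.
  have z k : close2 (b k) (Psi (fun=> 0)) (0, 0).
    by have := hPsi _ t0 k; rewrite bend0 (stage0 (proj1 (hEb k))).
  apply: dist2_eq0; apply/eqP; rewrite eq_le dist2_ge0 andbT leNgt; apply/negP => d0.
  have [k bk] := small _ d0; have /dist2_le := z k; lra.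
- move=> y ty; have pos_coord (x : R) : (forall k, - b k <= x) -> 0 <= x.
    move=> hx; rewrite leNgt; apply/negP => x0; have [|k bk] := small (- x); first lra.
    by have := hx k; lra.
  have sq k : square (E k (bend (y k))).
    by apply: (stage_square (proj1 (hEb k))); apply: bend_square; have [] := ty k.
  by split; apply: pos_coord => k; have [h1 h2] := hPsi y ty k; have [s1 s2] := sq k;
    move: h1 h2; rewrite !ler_norml; lra.
Qed.

End PlanarLimit.

(** * The planar embedding of the inverse limit *)

Section PlanarEmbedding.
Variable R : realType.
Implicit Types (e d r u v : R) (z w p q : R * R) (i j k m n : nat).

Lemma cvg_close2 (U : Type) (F : set_system U) {FF : Filter F} (h : U -> R * R) z :
  (forall e, 0 < e -> \forall u \near F, close2 e (h u) z) -> h @ F --> z.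
Proof.
move=> hz; apply/cvg_ballP => e e0; have e2 : 0 < e / 2 by rewrite divr_gt0.
apply: filterS (hz _ e2) => u [h1 h2]; split; rewrite /ball /= distrC.
  by apply: le_lt_trans h1 _; lra.
by apply: le_lt_trans h2 _; lra.
Qed.

Lemma close2_near (U : topologicalType) (h : U -> R * R) (x : U) e : continuous h -> 0 < e ->
  \forall y \near x, close2 e (h y) (h x).
Proof.
move=> ch e0; have /cvg_ballP/(_ e e0) := ch x; apply: filterS => y [].
by rewrite /ball /= => h1 h2; split; rewrite distrC; exact: ltW.
Qed.

Lemma nbhs_close2 z r : 0 < r -> \forall w \near z, close2 r z w.
Proof.
move=> r0; have : \forall w \near z, close2 r (id w) (id z).
  by apply: close2_near => // ?; exact: cvg_id.
by apply: filterS => w; exact: close2_sym.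
Qed.

Variables f T sigma : nat -> R -> R.
Hypotheses (cf : forall n, continuous (f n)) (f0 : forall n, f n 0 = 0).
Hypotheses (cT : forall k, continuous (T k)) (T0 : forall k, T k 0 = 0).
Hypothesis (uT : forall k, unit_map (T k)).
Hypotheses (cs : forall k, continuous (sigma k)) (s0 : forall k, sigma k 0 = 0).
Hypothesis (us : forall k, unit_map (sigma k)).
Hypothesis Ts : forall k x, - 1 <= x <= 1 -> T k (sigma k x) = f k.*2 (f k.*2.+1 x).
Hypothesis nd : forall k x1 x2, 0 <= x1 <= 1 -> 0 <= x2 <= 1 ->
  ~ negative_departure (sigma k \o T k.+1) x1 x2.

Let G k := sigma k \o T k.+1.
Let X := inverse_limit f.
Implicit Types x y : {ptws nat -> R}.

(** Since [T k \o sigma k] is [f k.*2 \o f k.*2.+1] on the interval, the even entries of [x] and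
    these lifts alternate along [T 0, sigma 0, T 1, sigma 1, ...]; dropping the former leaves a
    thread of [G]. *)
Definition lifted_thread (x : nat -> R) k := sigma k (x k.+1.*2).

Lemma inverse_limit_unit x n : X x -> - 1 <= x n <= 1.
Proof. by move=> [/(_ n)]; rewrite in_itv. Qed.

Lemma inverse_limit_even x k : X x -> x k.*2 = T k (lifted_thread x k).
Proof.
move=> Xx; rewrite Ts; last exact: inverse_limit_unit.
by case: Xx => _ hx; rewrite doubleS !hx.
Qed.

Lemma thread_lifted x : X x -> thread G (lifted_thread x).
Proof.
move=> Xx k; split; first exact/us/inverse_limit_unit.
by rewrite /G /= -inverse_limit_even.
Qed.

Lemma lifted_thread0 : lifted_thread (fun=> 0) = (fun=> 0).
Proof. by apply/funext => k; rewrite /lifted_thread s0. Qed.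

Lemma inverse_limit0 : X (fun=> 0).
Proof. by split=> n; rewrite ?in_itv ?f0 //= lerN10 ler01. Qed.

(** An even entry is read off with [T]; an odd one is the [f n]-image of the next even entry, hence
    [uphalf n]. *)
Definition coordinate n := if odd n then f n \o T (uphalf n) else T (uphalf n).

Lemma coordinateE x n : X x -> x n = coordinate n (lifted_thread x (uphalf n)).
Proof.
move=> Xx; rewrite /coordinate; case: ifP => on /=; rewrite -inverse_limit_even //.
  by case: Xx => _ hx; rewrite -{1}(hx n) -[n.+1]odd_double_half /= on.
by rewrite -[in LHS](odd_double_half n) on uphalf_half on.
Qed.

Lemma continuous_coordinate n : continuous (coordinate n).
Proof.
rewrite /coordinate; case: ifP => _; last exact: cT.
exact: continuous_compU (@cT _) (@cf _).
Qed.

Lemma accessible_embedding : exists Omega : {ptws nat -> R} -> R * R,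
  embedding X Omega /\ accessible X Omega (fun _ : nat => 0).
Proof.
have cG k : continuous (G k) by exact: continuous_compU (@cT _) (@cs _).
have G0 k : G k 0 = 0 by rewrite /G /= T0 s0.
have uG k : unit_map (G k) by move=> x x1; apply/us/uT.
have [E [b [Psi [st small apx Psi0 quad]]]] := planar_limit cG G0 uG nd.
pose Omega x := Psi (lifted_thread x).
pose p k x := E k (bend (lifted_thread x k)).
have Op x k : X x -> close2 (b k) (Omega x) (p k x).
  by move=> Xx; apply: apx; exact: thread_lifted.
have cp k : continuous (p k).
  have cx : continuous (fun x : {ptws nat -> R} => x k.+1.*2).
    exact: (@proj_continuous nat (fun=> R) k.+1.*2).
  have := continuous_compU (continuous_compU cx (@cs k)) (@continuous_bend R).
  by move=> /continuous_compU; apply; exact: stage_continuous (st k).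
(* This uniform separation yields both injectivity and continuity of the inverse. *)
have sep n e : 0 < e -> exists2 r, 0 < r & forall x y, X x -> X y ->
    close2 r (Omega x) (Omega y) -> `|x n - y n| < e.
  move=> e0; have [d d0 hd] := uniform_modulus (- 1) 1 (@continuous_coordinate n) e0.
  pose k := maxn (uphalf n) (Num.truncn d^-1).
  have kd : k.+1%:R^-1 < d.
    rewrite -[ltRHS]invrK ltf_pV2 ?posrE ?invr_gt0 ?ltr0n //.
    by apply: lt_le_trans (truncnS_gt _) _; rewrite ler_nat ltnS leq_maxr.
  exists (b k); first exact: stage_gt0 (st k).
  move=> x y Xx Xy xy; have tx := thread_lifted Xx; have ty := thread_lifted Xy.
  rewrite (coordinateE n Xx) (coordinateE n Xy); apply: hd.
  - by have [] := tx (uphalf n).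
  - by have [] := ty (uphalf n).
  - apply: le_lt_trans (spread_thread tx ty (leq_maxl _ (Num.truncn d^-1))) _.
    apply: lt_trans kd; apply: (stage_separates (st k)); first by have [] := tx k.
      by have [] := ty k.
    have -> : 3 * b k = b k + b k + b k by ring.
    apply: close2_trans (Op y k Xy); apply: close2_trans xy.
    by apply: close2_sym; exact: Op.
have inj x y : X x -> X y -> Omega x = Omega y -> x = y.
  move=> Xx Xy xy; apply/funext => n; apply/eqP; rewrite -subr_eq0 -normr_eq0.
  rewrite eq_le normr_ge0 andbT leNgt; apply/negP => e0.
  have [r r0 hr] := sep n _ e0; have := hr x y Xx Xy.
  by rewrite ltxx xy /close2 !subrr normr0 => h; have : false by apply: h; split; lra.
have [g hg] : exists g : R * R -> {ptws nat -> R}, forall x, X x -> g (Omega x) = x.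
  have /choice[g hg] : forall z, exists x, (Omega @` X) z -> X x /\ Omega x = z.
    move=> z; have [[x Xx xz]|nz] := pselect ((Omega @` X) z); first by exists x.
    by exists (fun=> 0).
  exists g => x Xx; have [|Xg Og] := hg (Omega x); first by exists x.
  exact: inj.
have O0 : Omega (fun=> 0) = (0, 0) by rewrite /Omega lifted_thread0 Psi0.
exists Omega; split.
  split.
    (* On [X], [Omega] is the uniform limit of the continuous maps [p k]. *)
    apply/subspace_continuousP => x Xx; apply: cvg_close2 => e e0.
    have e3 : 0 < e / 3 by rewrite divr_gt0.
    have [k bk] := small _ e3.
    have pk : \forall y \near x, close2 (e / 3) (p k y) (p k x) by exact: close2_near.
    near=> y.
    have Xy : X y by near: y; exact: withinT.
    have yx : close2 (e / 3) (p k y) (p k x).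
      by near: y; exact: cvg_within pk.
    have := close2_trans (close2_trans (Op y k Xy) yx) (close2_sym (Op x k Xx)).
    by rewrite /close2 => -[h1 h2]; split; lra.
  exists g; split => //; apply/subspace_continuousP => _ [x Xx <-].
  rewrite /from_subspace (hg x Xx).
  apply/pointwise_cvgP => n; apply/cvgrPdist_lt => e e0; have [r r0 hr] := sep n e e0.
  suff gx : \forall z \near within (Omega @` X) (nbhs (Omega x)), `|x n - g z n| < e by exact: gx.
  have rx := nbhs_close2 (Omega x) r0; near=> z.
  have [y Xy yz] : (Omega @` X) z by near: z; exact: withinT.
  rewrite -yz (hg y Xy); apply: hr => //; rewrite yz.
  by near: z; exact: cvg_within rx.
(* From the origin this segment enters the open negative quadrant, away from the image. *)
exists ((fun u => (- u, - u)) @` `[0 : R, 1]); split.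
  exists (fun u => (- u, - u)); split => //; split.
    apply: continuous_subspaceT; apply: continuous_pairing; exact: opp_continuous.
  exists (fun z => - z.1); split => [u _ /=|]; first by rewrite opprK.
  by apply: continuous_subspaceT => z; apply: cvgN; exact: cvg_fst.
rewrite O0; apply/seteqP; split => [z [[u /= u01 <-] [x Xx xu]]|_ ->].
  have [] := quad _ (thread_lifted Xx); rewrite -/(Omega x) xu /=.
  move: u01; rewrite in_itv /= => u01 h1 _; have -> : u = 0 by lra.
  by rewrite oppr0.
split; first by exists 0; rewrite /= ?oppr0 // in_itv /= lexx ler01.
by exists (fun=> 0); [exact: inverse_limit0|].
Unshelve. all: end_near.
Qed.

End PlanarEmbedding.

(** * From maps on the interval to maps on the line *)

Section Restriction.
Variable R : realType.
Implicit Types (f g h t T sigma : R -> R) (u x y z : R).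

(** Retraction of the line onto [[-1, 1]]: composing with it turns a map given on the interval into
    a globally continuous one with the same values there. *)
Definition unit_clamp x : R := Num.max (- 1) (Num.min 1 x).

Lemma unit_clampE x : - 1 <= x <= 1 -> unit_clamp x = x.
Proof. by move=> /andP[x1 x2]; rewrite /unit_clamp (min_idPr x2) (max_idPr x1). Qed.

Lemma unit_clamp_bounds x : - 1 <= unit_clamp x <= 1.
Proof. by apply: clamp_between; lra. Qed.

Lemma continuous_unit_clamp : continuous unit_clamp.
Proof.
apply: continuous_maxr; first by move=> ?; exact: cvg_cst.
by apply: continuous_minr => ?; [exact: cvg_cst|exact: cvg_id].
Qed.

Lemma selfmap_clamp f : selfmap f -> continuous (f \o unit_clamp) /\ unit_map (f \o unit_clamp).
Proof.
have cl x : unit_clamp x \in `[-1, 1] by rewrite in_itv /= unit_clamp_bounds.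
move=> [/subspace_continuousP cf uf]; split=> [x|x _]; last first.
  by have := uf _ (cl x); rewrite in_itv.
apply: cvg_trans (cf (unit_clamp x) (cl x)) => P /= hP.
have : \forall y \near unit_clamp x, y \in `[-1, 1] -> P (f y) by exact: hP.
move=> /(@continuous_unit_clamp x) hx.
have : \forall y \near x, unit_clamp y \in `[-1, 1] -> P (f (unit_clamp y)) by exact: hx.
by apply: filterS => y; apply; exact: cl.
Qed.

Lemma contour_factor_eq f g t : (forall x, 0 <= x <= 1 -> f x = g x) ->
  contour_factor f t -> contour_factor g t.
Proof.
move=> fg [s [srt mem n0 val aff]]; exists s; split => //.
  move=> x; rewrite mem; split; apply: contour_point_eq => // y y01.
  by rewrite fg.
move=> i ilt; rewrite val //; apply: fg; case: i ilt => [|i] ilt /=; first by rewrite lexx ler01.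
by have /mem [/departureP[h _] _] := mem_nth 0 ilt; lra.
Qed.

Lemma radial_contour_factor_eq f g t : (forall x, - 1 <= x <= 1 -> f x = g x) ->
  radial_contour_factor f t -> radial_contour_factor g t.
Proof.
by move=> fg [h1 h2]; split; [move: h1|move: h2]; apply: contour_factor_eq => x x01 /=;
  apply: fg; lra.
Qed.

Lemma no_contour_twins_eq f g : (forall x, - 1 <= x <= 1 -> f x = g x) ->
  no_contour_twins f -> no_contour_twins g.
Proof.
move=> fg [[nmin nmax] tw]; have fg0 : f 0 = g 0 by apply: fg; lra.
have near0 : \forall y \near (0 : R), f y = g y.
  by apply/nbhs_ballP; exists 1 => //= y; rewrite /ball /= sub0r normrN ltr_norml => ?;
    apply: fg; lra.
split.
  split; [move=> h; apply: nmin|move=> h; apply: nmax];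
    by apply: filterS2 near0 h => y fgy; rewrite fgy fg0.
move=> a b ca [b0 cb] a01 b01; rewrite -!fg; [|lra|lra].
apply: tw => //.
  by move: ca; apply: contour_point_eq => y y01; rewrite fg //; lra.
split => //; move: cb; apply: contour_point_eq => y y01 /=; rewrite fg //; lra.
Qed.

Lemma radial_lift_unit f h T sigma : unit_map f -> radial_lift f h T sigma -> unit_map T.
Proof.
move=> uf [_ _ [sr [sl [hr hl]]] _ _] u u1; case: (le_or_lt 0 u) => u0.
  have [|x [x01 <- hx]] := hr u; first lra.
  by have [|_ <-] := hx x; [lra|apply: uf; lra].
have [|x [x01 su hx]] := hl (- u); first lra.
by have [|_] := hx x; [lra|rewrite /= su opprK => <-; apply: uf; lra].
Qed.

End Restriction.

Theorem theorem7p3 (R : realType) (f : nat -> R -> R)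
  (f_map : forall n, selfmap (f n))
  (f_pl : forall n, piecewise_linear (-1) 1 (f n))
  (f_zero : forall n, f n 0 = 0)
  (f_left : forall n, ~ constant_on (-1) 0 (f n))
  (f_right : forall n, ~ constant_on 0 1 (f n))
  (f_factor : forall n, same_radial_contour_factor (f n) (f n \o f n.+1))
  (f_twins : forall n, no_contour_twins (f n)) :
  exists Omega : {ptws nat -> R} -> R * R,
    embedding (inverse_limit f) Omega /\
    accessible (inverse_limit f) Omega (fun _ : nat => 0).
Proof.
pose F n := f n \o @unit_clamp R.
have FE n x : - 1 <= x <= 1 -> f n x = F n x by move=> x1; rewrite /F /= unit_clampE.
have cF n : continuous (F n) by have [] := selfmap_clamp (f_map n).
have uF n : unit_map (F n) by have [] := selfmap_clamp (f_map n).
have F0 n : F n 0 = 0 by rewrite -FE ?f_zero //; lra.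
have limF : inverse_limit f = inverse_limit F.
  apply/seteqP; split=> x [x1 hx]; split => // n.
    by rewrite -FE ?hx //; have := x1 n.+1; rewrite in_itv.
  by rewrite FE ?hx //; have := x1 n.+1; rewrite in_itv.
have twF n : twinless (F n).
  apply: no_contour_twins_twinless => //.
  exact: no_contour_twins_eq (FE n) (f_twins n).
have /choice[T /choice[sigma lift]] n : exists T, exists sigma, radial_lift (F n) (F n.+1) T sigma.
  have [t [tf tff]] := f_factor n; apply: (radial_lift_exists (t := t)) => //.
    exact: radial_contour_factor_eq (FE n) tf.
  apply: radial_contour_factor_eq tff => x x1 /=.
  by rewrite (FE n.+1) // FE //; exact: uF.
have sub n : subordinate (F n) (F n.+1) by have [] := lift n.
(* The lifts at even indices tile the sequence: [sigma k.*2] belongs to the pair [F k.*2],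
   [F k.*2.+1], and [T k.*2.+2] to the map that follows. *)
rewrite limF; apply: (accessible_embedding (T := fun k => T k.*2) (sigma := fun k => sigma k.*2)) => //.
- by move=> k; have [[]] := lift k.*2.
- by move=> k; have [[]] := lift k.*2.
- by move=> k; exact: radial_lift_unit (lift k.*2).
- by move=> k; have [[]] := lift k.*2.
- by move=> k; have [[]] := lift k.*2.
- by move=> k; have [[]] := lift k.*2.
- by move=> k; have [] := lift k.*2.
- move=> k x1 x2; have li := lift k.*2; have li' := lift k.*2.+2.
  exact: radial_lift_departure li li' (cF _) (F0 _) (@uF _) (twF _) (twF _) (sub _).
Qed.
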